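(* Let $H:\mathbb{C}_+\to\mathbb{C}_+$ be a holomorphic function and denote by $\{\Phi_t\}_{t\ge0}$ the continuous semigroup in $\mathbb{C}_+$ whose infinitesimal generator is $H$. Then the following statements are equivalent: (i) $H\in H^{\infty}(\mathbb{C}_{\varepsilon})$ for some $\varepsilon>0$. (ii) $H\in H^{\infty}(\mathbb{C}_{\varepsilon})$ for all $\varepsilon>0$. (iii) There exist a constant $K>0$ and $\varepsilon_0>0$ such that $$\sup_{z\in\mathbb{C}_{\varepsilon}}|H(z)|\leq\frac{K}{\varepsilon},\quad\text{for all } 0<\varepsilon<\varepsilon_0.$$ (iv) There exist two constants $C>0$ and $t_0>0$ such that if $0\leq t<t_0$, then $$|\Phi_t(z)-z|\leq C\sqrt{t},\quad\text{for all } z\in\mathbb{C}_+.$$ (v) $\{\Phi_t\}$ converges to the identity map uniformly on $\mathbb{C}_+$, as $t$ goes to zero. (vi) There exists $\varepsilon>0$ such that $\{\Phi_t\}$ converges to the identity map uniformly on $\mathbb{C}_{\varepsilon}$, as $t$ goes to zero.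
   Context: For $\varepsilon\ge 0$, $\mathbb{C}_{\varepsilon}=\{s\in\mathbb{C}:\mathrm{Re}(s)>\varepsilon\}$, and $\mathbb{C}_+=\mathbb{C}_0$. $H^{\infty}(\mathbb{C}_{\varepsilon})$ is the space of bounded analytic functions in $\mathbb{C}_{\varepsilon}$ (''$H\in H^\infty(\mathbb{C}_\varepsilon)$'' refers to the restriction of $H$ to $\mathbb{C}_\varepsilon$). A continuous semigroup in a domain $\Omega\subset\mathbb{C}$ is a family $\{\Phi_t\}_{t\geq 0}$ of holomorphic functions $\Phi_t:\Omega\to\Omega$ such that: (i) $\Phi_0(z)=z$ for all $z\in\Omega$; (ii) $\Phi_t\circ\Phi_u=\Phi_{t+u}$ for all $t,u\geq 0$; (iii) $\Phi_t\to\Phi_0$ uniformly on compact subsets of $\Omega$ as $t\to 0^+$. Its infinitesimal generator is the holomorphic function $H(z)=\lim_{t\to 0^+}\frac{\Phi_t(z)-z}{t}$, $z\in\Omega$ (limit uniform on compact sets), and $t\mapsto\Phi_t(z)$ is the solution of $\frac{\partial\Phi_t(z)}{\partial t}=H(\Phi_t(z))$, $\Phi_0(z)=z$. By a theorem of Berkson and Porta, every holomorphic $H:\mathbb{C}_+\to\mathbb{C}$ with $H(\mathbb{C}_+)\subset\overline{\mathbb{C}_+}$ is the infinitesimal generator of a unique continuous semigroup in $\mathbb{C}_+$. *)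

(* Defs.v *)
From Stdlib Require Import Reals List.
From Coquelicot Require Import Coquelicot.

Open Scope R_scope.

Definition half_plane (eps : R) (z : C) : Prop := eps < Re z.

(** A holomorphic function on an open set [Om] of [C] is represented by a total
    function [C -> C], whose values outside [Om] are irrelevant. *)
Definition holomorphic_on (Om : C -> Prop) (f : C -> C) : Prop :=
  forall z, Om z -> @ex_derive C_AbsRing C_NormedModule f z.

Definition maps_into (A B : C -> Prop) (f : C -> C) : Prop :=
  forall z, A z -> B (f z).

Definition Hinfty (Om : C -> Prop) (f : C -> C) : Prop :=
  holomorphic_on Om f /\
  exists M : R, forall z, Om z -> Cmod (f z) <= M.

(** Supremum of [|f|] over [A], as an extended real number. *)
Definition sup_Cmod (A : C -> Prop) (f : C -> C) : Rbar :=
  Lub_Rbar (fun r => exists z, A z /\ r = Cmod (f z)).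

Definition compact_set {T : UniformSpace} (K : T -> Prop) : Prop :=
  forall (I : Type) (U : I -> T -> Prop),
    (forall i, open (U i)) ->
    (forall z, K z -> exists i, U i z) ->
    exists l : list I, forall z, K z -> exists i, In i l /\ U i z.

(** [F t] converges to [G], uniformly on [A], as [t] tends to 0 from the right. *)
Definition cv_unif_0 (A : C -> Prop) (F : R -> C -> C) (G : C -> C) : Prop :=
  forall eps : posreal,
    at_right 0 (fun t => forall z, A z -> Cmod (F t z - G z)%C < eps).

Definition cv_compacts_0 (Om : C -> Prop) (F : R -> C -> C) (G : C -> C) : Prop :=
  forall K : C -> Prop,
    @compact_set C_UniformSpace K -> (forall z, K z -> Om z) ->
    cv_unif_0 K F G.

(** Only the values [Phi t z] with [0 <= t] and [z] in [Om] matter. *)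
Record continuous_semigroup (Om : C -> Prop) (Phi : R -> C -> C) : Prop := {
  semigroup_holo : forall t, 0 <= t -> holomorphic_on Om (Phi t);
  semigroup_maps : forall t, 0 <= t -> maps_into Om Om (Phi t);
  semigroup_0 : forall z, Om z -> Phi 0 z = z;
  semigroup_comp : forall t u, 0 <= t -> 0 <= u ->
    forall z, Om z -> Phi t (Phi u z) = Phi (t + u) z;
  semigroup_cont : cv_compacts_0 Om Phi (Phi 0)
}.

Definition infinitesimal_generator
    (Om : C -> Prop) (Phi : R -> C -> C) (H : C -> C) : Prop :=
  holomorphic_on Om H /\
  cv_compacts_0 Om (fun t z => ((Phi t z - z) / RtoC t)%C) H.

Definition all_equivalent (l : list Prop) : Prop :=
  forall P Q, In P l -> In Q l -> (P <-> Q).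

(* Main.v *)
Require Import Defs.
From Stdlib Require Import Reals List Lra Classical.
From Coquelicot Require Import Coquelicot.
Import ListNotations.
Open Scope R_scope.

(** The implications rest on two facts about a holomorphic self-map of the right
    half-plane: the Schwarz-Pick inequality, and, for the square-root rate, the
    existence of a primitive of [sqrt H].

    Static part. Schwarz-Pick on the disc of centre [X + iy] tangent to the
    imaginary axis gives [|H (x + iy)| <= (2 X / x) |H (X + iy)|] for [x < X]
    ([bound_near_boundary]), so a bound on one half-plane spreads to all of them,
    with the rate [K / eps].

    From uniform convergence to boundedness. Far from the imaginary axis a
    displacement smaller than 1 changes [H] by at most half of its value, by
    Schwarz-Pick. If all displacements up to time [T] are smaller than 1, the
    trajectory of [z] therefore runs in a nearly constant direction at a speed
    at least [|H z| / 2], and [|H z|] is at most a constant over [T]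
    ([bounded_of_uniform]).

    From the rate [K / eps] to the rate [sqrt t]. Put [h = sqrt t]. The bound
    [|H| <= K / Re z] alone does not control a trajectory that starts close to the
    imaginary axis and might run along it for a while. Instead, let [F] be a primitive of
    [v = sqrt H] and follow [Re F] along the trajectory, where its derivative is
    [Re (v H) = Re (v^3)]. When [H] is almost imaginary, that is, when the motion
    is almost parallel to the axis, this derivative is negative and comparable
    with [- |H|^(3/2)]; in general
    [|H|^(3/2) / 2 <= - Re (v H) + 2 |v| Re H] ([half_cube_le]).
    Since [|v| <= k / sqrt (Re z)] is integrable up to the axis, the two terms on
    the right integrate to at most [C (sqrt h + D / sqrt h)], where [D] is the
    displacement: for the first one, compare [Re F] at the two end points by
    moving away from the axis by [h], across, and back. Thus
    [|H|^(3/2)] is integrable along the trajectory, and with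
    [|H| <= mu^2 + |H|^(3/2) / mu] and [mu] a large multiple of [1 / sqrt h] this
    gives [D <= C h] ([displacement]).

    The complex analysis needed is built from the Cauchy-Goursat theorem on
    rectangles: pulled back by the exponential it yields mean values over circles,
    hence Schwarz-Pick; in the half-plane it yields primitives. The generator is
    defined by right derivatives at time 0, and [flow_curve_deriv] turns them into
    the differential equation [d Phi_t(z) / dt = H (Phi_t(z))] for [t > 0]. *)

(** * Complex differentiability through slope functions *)

Definition near (z : C) (P : C -> Prop) : Prop :=
  exists d, 0 < d /\ forall w, Cmod (w - z) < d -> P w.

Definition cont (f : C -> C) (z : C) : Prop :=
  forall e, 0 < e -> near z (fun w => Cmod (f w - f z) < e).

(** Caratheodory's form of the derivative: the difference quotient extends
    continuously to [z]. The differentiation rules then reduce to algebra on the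
    slope functions [phi]. The identity is local so that [Cinv] qualifies. *)
Definition cderiv (f : C -> C) (z l : C) : Prop :=
  exists phi, cont phi z /\ phi z = l /\
    near z (fun w => f w - f z = phi w * (w - z))%C.

Definition cdiff (f : C -> C) (z : C) : Prop := exists l, cderiv f z l.

Lemma near_and z P Q : near z P -> near z Q -> near z (fun w => P w /\ Q w).
Proof.
  intros [d [Hd H]] [d' [Hd' H']]. exists (Rmin d d'). split.
  - now apply Rmin_glb_lt.
  - intros w Hw. split.
    + apply H. eapply Rlt_le_trans; [exact Hw | apply Rmin_l].
    + apply H'. eapply Rlt_le_trans; [exact Hw | apply Rmin_r].
Qed.

Lemma near_mono z (P Q : C -> Prop) : (forall w, P w -> Q w) -> near z P -> near z Q.
Proof. intros PQ [d [Hd H]]. exists d; split; auto. Qed.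

Lemma near_self z P : near z P -> P z.
Proof.
  intros [d [Hd H]]. apply H. replace (z - z)%C with (RtoC 0) by ring.
  now rewrite Cmod_0.
Qed.

Lemma Cmod_sub_sym z w : Cmod (z - w) = Cmod (w - z).
Proof. rewrite <- (Cmod_opp (w - z)). f_equal. ring. Qed.

Lemma Cmod_triangle_sub z w : Cmod z <= Cmod w + Cmod (z - w).
Proof.
  replace z with (w + (z - w))%C at 1 by ring. apply Cmod_triangle.
Qed.

Lemma Cmod_triangle_minus z w : Cmod (z - w) <= Cmod z + Cmod w.
Proof. unfold Cminus. rewrite <- (Cmod_opp w). apply Cmod_triangle. Qed.

Lemma im_le_Cmod z : Rabs (Im z) <= Cmod z.
Proof.
  replace (Im z) with (- Re (z * Ci)) by (rewrite re_mult_Ci; lra).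
  rewrite Rabs_Ropp. eapply Rle_trans; [apply re_le_Cmod|].
  rewrite Cmod_mult, Cmod_Ci. lra.
Qed.

Lemma Cmod_le_re_im z : Cmod z <= Rabs (Re z) + Rabs (Im z).
Proof.
  apply Rsqr_incr_0_var.
  - rewrite !Rsqr_pow2, Cmod2_alt.
    rewrite <- (pow2_abs (Re z)), <- (pow2_abs (Im z)).
    pose proof (Rabs_pos (Re z)); pose proof (Rabs_pos (Im z)). nra.
  - pose proof (Rabs_pos (Re z)); pose proof (Rabs_pos (Im z)). lra.
Qed.

Lemma re_minus z w : Re (z - w) = Re z - Re w.
Proof. unfold Cminus. rewrite re_plus, re_opp. lra. Qed.

Lemma im_minus z w : Im (z - w) = Im z - Im w.
Proof. unfold Cminus. rewrite im_plus, im_opp. lra. Qed.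

Lemma cont_const c z : cont (fun _ => c) z.
Proof.
  intros e He. exists 1. split; [lra|]. intros w _.
  replace (c - c)%C with (RtoC 0) by ring. now rewrite Cmod_0.
Qed.

Lemma cont_id z : cont (fun w => w) z.
Proof. intros e He. exists e. split; auto. Qed.

Lemma cont_plus f g z : cont f z -> cont g z -> cont (fun w => f w + g w)%C z.
Proof.
  intros Hf Hg e He.
  generalize (near_and _ _ _ (Hf (e / 2) ltac:(lra)) (Hg (e / 2) ltac:(lra))).
  apply near_mono. intros w [H1 H2].
  replace (f w + g w - (f z + g z))%C with ((f w - f z) + (g w - g z))%C by ring.
  eapply Rle_lt_trans; [apply Cmod_triangle | lra].
Qed.

Lemma cont_mult f g z : cont f z -> cont g z -> cont (fun w => f w * g w)%C z.
Proof.
  intros Hf Hg e He.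
  set (M := 1 + Cmod (f z) + Cmod (g z)).
  assert (HM : 1 <= M) by (unfold M; pose proof (Cmod_ge_0 (f z)); pose proof (Cmod_ge_0 (g z)); lra).
  set (d := Rmin 1 (e / (2 * M))).
  assert (Hd : 0 < d).
  { apply Rmin_glb_lt; [lra|]. apply Rdiv_lt_0_compat; lra. }
  assert (Hd1 : d <= 1) by apply Rmin_l.
  assert (Hd2 : d * (2 * M) <= e).
  { replace e with (e / (2 * M) * (2 * M)) at 1 by (field; lra).
    apply Rmult_le_compat_r; [lra | apply Rmin_r]. }
  generalize (near_and _ _ _ (Hf d Hd) (Hg d Hd)).
  apply near_mono. intros w [H1 H2].
  replace (f w * g w - f z * g z)%C
    with ((f w - f z) * (g w - g z) + (f z * (g w - g z) + (f w - f z) * g z))%C by ring.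
  eapply Rle_lt_trans; [apply Cmod_triangle|].
  eapply Rle_lt_trans; [apply Rplus_le_compat_l, Cmod_triangle|].
  rewrite !Cmod_mult.
  pose proof (Cmod_ge_0 (f w - f z)); pose proof (Cmod_ge_0 (g w - g z)).
  pose proof (Cmod_ge_0 (f z)); pose proof (Cmod_ge_0 (g z)).
  assert (Cmod (f w - f z) * Cmod (g w - g z) <= d * 1) by nra.
  assert (Cmod (f z) * Cmod (g w - g z) <= Cmod (f z) * d) by nra.
  assert (Cmod (f w - f z) * Cmod (g z) <= d * Cmod (g z)) by nra.
  unfold M in *. nra.
Qed.

Lemma cont_comp f g z : cont f z -> cont g (f z) -> cont (fun w => g (f w)) z.
Proof.
  intros Hf Hg e He. destruct (Hg e He) as [d [Hd H]].
  generalize (Hf d Hd). apply near_mono. auto.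
Qed.

Lemma cont_near f z P : cont f z -> near (f z) P -> near z (fun w => P (f w)).
Proof. intros Hf [d [Hd H]]. generalize (Hf d Hd). apply near_mono. auto. Qed.

Lemma cont_inv (z : C) : z <> 0 -> cont Cinv z.
Proof.
  intros Hz e He. apply Cmod_gt_0 in Hz as Hm.
  set (m := Cmod z) in *.
  exists (Rmin (m / 2) (e * (m * m) / 2)). split.
  - apply Rmin_glb_lt; [lra|]. assert (0 < m * m) by nra. assert (0 < e * (m*m)) by nra. lra.
  - intros w Hw.
    assert (H1 : Cmod (w - z) < m / 2) by (eapply Rlt_le_trans; [exact Hw | apply Rmin_l]).
    assert (H2 : Cmod (w - z) < e * (m * m) / 2) by (eapply Rlt_le_trans; [exact Hw | apply Rmin_r]).
    assert (H3 : m / 2 < Cmod w).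
    { pose proof (Cmod_triangle_sub z w) as T. rewrite Cmod_sub_sym in T. fold m in T. lra. }
    assert (Hw0 : w <> 0) by (apply Cmod_gt_0; lra).
    replace (/ w - / z)%C with (- (w - z) * / (w * z))%C by (field; split; auto).
    rewrite Cmod_mult, Cmod_opp, Cmod_inv, Cmod_mult by (apply Cmult_neq_0; auto).
    fold m. apply (Rmult_lt_reg_r (Cmod w * m)); [nra|].
    rewrite Rmult_assoc, Rinv_l by nra.
    assert (e * (m * m) / 2 <= e * (Cmod w * m)); [|lra].
    assert (m * m / 2 <= Cmod w * m) by nra. nra.
Qed.

Lemma cont_finv f z : cont f z -> f z <> 0 -> cont (fun w => / f w)%C z.
Proof. intros Hf H. apply (cont_comp f Cinv); auto. now apply cont_inv. Qed.

Lemma cont_congr f g z : near z (fun w => f w = g w) -> cont f z -> cont g z.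
Proof.
  intros E Hf e He. pose proof (near_self _ _ E) as Ez. simpl in Ez.
  generalize (near_and _ _ _ E (Hf e He)). apply near_mono.
  intros w [H1 H2]. now rewrite <- H1, <- Ez.
Qed.

Lemma cderiv_cont f z l : cderiv f z l -> cont f z.
Proof.
  intros [phi [C [_ N]]].
  apply (cont_congr (fun w => f z + phi w * (w + - z))%C).
  - revert N. apply near_mono. intros w E.
    replace (f w) with (f z + (f w - f z))%C by ring. rewrite E. ring.
  - apply cont_plus; [apply cont_const|]. apply cont_mult; auto.
    apply cont_plus; [apply cont_id | apply cont_const].
Qed.

Lemma cdiff_cont f z : cdiff f z -> cont f z.
Proof. intros [l H]. eapply cderiv_cont; eauto. Qed.

Lemma cdiff_const c z : cdiff (fun _ => c) z.
Proof.
  exists 0, (fun _ => RtoC 0). repeat split; [apply cont_const|].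
  exists 1. split; [lra|]. intros. ring.
Qed.

Lemma cdiff_id z : cdiff (fun w => w) z.
Proof.
  exists 1, (fun _ => RtoC 1). repeat split; [apply cont_const|].
  exists 1. split; [lra|]. intros. ring.
Qed.

Lemma cdiff_plus f g z : cdiff f z -> cdiff g z -> cdiff (fun w => f w + g w)%C z.
Proof.
  intros [l [phi [C1 [_ N1]]]] [m [psi [C2 [_ N2]]]].
  eexists. exists (fun w => phi w + psi w)%C. repeat split; [now apply cont_plus|].
  generalize (near_and _ _ _ N1 N2). apply near_mono. intros w [E1 E2].
  replace (f w + g w - (f z + g z))%C with ((f w - f z) + (g w - g z))%C by ring.
  rewrite E1, E2. ring.
Qed.

Lemma cdiff_mult f g z : cdiff f z -> cdiff g z -> cdiff (fun w => f w * g w)%C z.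
Proof.
  intros [l [phi [C1 [El N1]]]] Hg. pose proof (cdiff_cont _ _ Hg) as Cg.
  destruct Hg as [m [psi [C2 [Em N2]]]].
  eexists. exists (fun w => phi w * g w + f z * psi w)%C. repeat split.
  - apply cont_plus; apply cont_mult; auto. apply cont_const.
  - generalize (near_and _ _ _ N1 N2). apply near_mono. intros w [E1 E2].
    replace (f w * g w - f z * g z)%C with ((f w - f z) * g w + f z * (g w - g z))%C by ring.
    rewrite E1, E2. ring.
Qed.

Lemma cderiv_comp f g z l m :
  cderiv f z l -> cderiv g (f z) m -> cderiv (fun w => g (f w)) z (m * l)%C.
Proof.
  intros Hf [psi [C2 [Em N2]]]. pose proof (cderiv_cont _ _ _ Hf) as Cf.
  destruct Hf as [phi [C1 [El N1]]].
  exists (fun w => psi (f w) * phi w)%C. repeat split.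
  - apply cont_mult; auto. apply (cont_comp f psi); auto.
  - now rewrite El, Em.
  - generalize (near_and _ _ _ N1 (cont_near _ _ _ Cf N2)). apply near_mono.
    intros w [E1 E2]. rewrite E2, E1. ring.
Qed.

Lemma cdiff_comp f g z : cdiff f z -> cdiff g (f z) -> cdiff (fun w => g (f w)) z.
Proof. intros [l Hf] [m Hg]. exists (m * l)%C. now apply cderiv_comp. Qed.

Lemma near_neq (z c : C) : z <> c -> near z (fun w => w <> c).
Proof.
  intros H. exists (Cmod (z - c)). split.
  - apply Cmod_gt_0. now apply Cminus_eq_contra.
  - intros w Hw E. subst w. rewrite Cmod_sub_sym in Hw. lra.
Qed.

Lemma cdiff_inv (z : C) : z <> 0 -> cdiff Cinv z.
Proof.
  intros Hz. eexists. exists (fun w => - / z * / w)%C. repeat split.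
  - apply cont_mult; [apply cont_const | now apply cont_inv].
  - generalize (near_neq z 0 Hz). apply near_mono. intros w Hw. field. auto.
Qed.

Lemma cdiff_finv f z : cdiff f z -> f z <> 0 -> cdiff (fun w => / f w)%C z.
Proof. intros Hf H. apply (cdiff_comp f Cinv); auto. now apply cdiff_inv. Qed.

Lemma cdiff_congr f g z : near z (fun w => f w = g w) -> cdiff f z -> cdiff g z.
Proof.
  intros E [l [phi [C1 [El N1]]]]. pose proof (near_self _ _ E) as Ez. simpl in Ez.
  exists l, phi. repeat split; auto.
  generalize (near_and _ _ _ E N1). apply near_mono. intros w [H1 H2].
  now rewrite <- H1, <- Ez.
Qed.

(** From right to left, the slope is the difference quotient, filled in at [z]
    by [l]. *)
Lemma cderiv_eps f z l :
  cderiv f z l <->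
  forall e, 0 < e ->
    near z (fun w => Cmod (f w - f z - l * (w - z)) <= e * Cmod (w - z)).
Proof.
  split.
  - intros [phi [C1 [<- N1]]] e He.
    generalize (near_and _ _ _ N1 (C1 e He)). apply near_mono. intros w [E1 E2].
    rewrite E1. replace (phi w * (w - z) - phi z * (w - z))%C
      with ((phi w - phi z) * (w - z))%C by ring.
    rewrite Cmod_mult. apply Rmult_le_compat_r; [apply Cmod_ge_0 | lra].
  - intros H.
    exists (fun w => if Ceq_dec w z then l else ((f w - f z) / (w - z))%C).
    assert (Ez : forall T (x y : T), (if Ceq_dec z z then x else y) = x).
    { intros. now destruct (Ceq_dec z z). }
    repeat split.
    + intros e He. rewrite Ez. generalize (H (e / 2) ltac:(lra)).
      apply near_mono. intros w Hw. destruct (Ceq_dec w z) as [->|Hn].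
      * replace (l - l)%C with (RtoC 0) by ring. now rewrite Cmod_0.
      * assert (Hn' : (w - z)%C <> 0) by now apply Cminus_eq_contra.
        pose proof (proj1 (Cmod_gt_0 _) Hn').
        replace ((f w - f z) / (w - z) - l)%C
          with ((f w - f z - l * (w - z)) / (w - z))%C by (field; auto).
        rewrite Cmod_div by auto.
        apply Rle_lt_trans with (e / 2); [|lra].
        apply (Rmult_le_reg_r (Cmod (w - z))); auto.
        unfold Rdiv at 1. rewrite Rmult_assoc, Rinv_l; lra.
    + apply Ez.
    + exists 1. split; [lra|]. intros w _. destruct (Ceq_dec w z) as [->|Hn]; [ring|].
      field. now apply Cminus_eq_contra.
Qed.

Lemma ex_derive_cdiff f z : @ex_derive C_AbsRing C_NormedModule f z -> cdiff f z.
Proof.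
  intros [l [_ Hl]]. exists l. apply cderiv_eps. intros e He.
  specialize (Hl z (fun P H => H) (mkposreal e He)).
  destruct Hl as [d Hd]. exists d. split; [apply cond_pos|].
  intros w Hw.
  specialize (Hd w Hw). simpl in Hd. 
  rewrite (Cmult_comm l). exact Hd.
Qed.

(** * Exponential and principal square root *)

Definition cexp (w : C) : C := (exp (Re w) * cos (Im w), exp (Re w) * sin (Im w)).

Lemma cexp_add z w : cexp (z + w) = (cexp z * cexp w)%C.
Proof.
  unfold cexp. rewrite re_plus, im_plus, exp_plus, cos_plus, sin_plus.
  apply injective_projections; simpl; ring.
Qed.

Lemma Cmod_cexp w : Cmod (cexp w) = exp (Re w).
Proof.
  pose proof (exp_pos (Re w)). unfold Cmod, cexp; simpl fst; simpl snd.
  replace (_ + _) with (Rsqr (exp (Re w))).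
  - apply sqrt_Rsqr. lra.
  - pose proof (sin2_cos2 (Im w)) as E. unfold Rsqr in *.
    transitivity (exp (Re w) * exp (Re w) * (sin (Im w) * sin (Im w) + cos (Im w) * cos (Im w))).
    + rewrite E; ring.
    + ring.
Qed.

Lemma small_increment (f : R -> R) l : derivable_pt_lim f 0 l ->
  forall e, 0 < e -> exists d, 0 < d /\
    forall x, Rabs x < d -> Rabs (f x - f 0 - l * x) <= e * Rabs x.
Proof.
  intros H e He. destruct (H e He) as [d Hd]. exists d. split; [apply cond_pos|].
  intros x Hx. destruct (Req_dec x 0) as [->|Hx0].
  - replace (f 0 - f 0 - l * 0) with 0 by ring. rewrite Rabs_R0. lra.
  - specialize (Hd x Hx0 Hx). rewrite Rplus_0_l in Hd.
    replace (f x - f 0 - l * x) with (((f x - f 0) / x - l) * x) by (field; auto).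
    rewrite Rabs_mult. apply Rmult_le_compat_r; [apply Rabs_pos | lra].
Qed.

Lemma cderiv_cexp_0 : cderiv cexp 0 1.
Proof.
  apply cderiv_eps. intros e He.
  set (e' := Rmin 1 (e / 8)).
  assert (He' : 0 < e') by (apply Rmin_glb_lt; lra).
  assert (He1 : e' <= 1) by apply Rmin_l.
  assert (He2 : e' <= e / 8) by apply Rmin_r.
  destruct (small_increment exp 1) with (e := e') as [d1 [D1 H1]]; auto.
  { rewrite <- exp_0. apply derivable_pt_lim_exp. }
  destruct (small_increment cos 0) with (e := e') as [d2 [D2 H2]]; auto.
  { pose proof (derivable_pt_lim_cos 0) as L. rewrite sin_0, Ropp_0 in L. exact L. }
  destruct (small_increment sin 1) with (e := e') as [d3 [D3 H3]]; auto.
  { rewrite <- cos_0. apply derivable_pt_lim_sin. }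
  exists (Rmin (Rmin d1 e') (Rmin d2 d3)). split.
  { apply Rmin_glb_lt; apply Rmin_glb_lt; assumption. }
  intros w Hw. replace (w - 0)%C with w in * by ring.
  assert (L1 := Rmin_l (Rmin d1 e') (Rmin d2 d3)).
  assert (L2 := Rmin_r (Rmin d1 e') (Rmin d2 d3)).
  assert (L3 := Rmin_l d1 e'). assert (L4 := Rmin_r d1 e').
  assert (L5 := Rmin_l d2 d3). assert (L6 := Rmin_r d2 d3).
  pose proof (re_le_Cmod w) as Rx. pose proof (im_le_Cmod w) as Ry.
  set (x := Re w) in *. set (y := Im w) in *. set (m := Cmod w) in *.
  assert (E1 : Rabs (exp x - 1 - x) <= e' * m).
  { specialize (H1 x ltac:(lra)). rewrite exp_0, Rmult_1_l in H1. nra. }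
  assert (E2 : Rabs (cos y - 1) <= e' * m).
  { specialize (H2 y ltac:(lra)). rewrite cos_0, Rmult_0_l, Rminus_0_r in H2. nra. }
  assert (E3 : Rabs (sin y - y) <= e' * m).
  { specialize (H3 y ltac:(lra)). rewrite sin_0, Rmult_1_l, Rminus_0_r in H3. nra. }
  assert (C1 : Rabs (cos y) <= 1) by (apply Rabs_le; pose proof (COS_bound y); lra).
  assert (S1 : Rabs (sin y) <= 2 * m).
  { replace (sin y) with ((sin y - y) + y) by ring.
    eapply Rle_trans; [apply Rabs_triang|]. pose proof (Cmod_ge_0 w). fold m in H. nra. }
  assert (X1 : Rabs (exp x - 1) <= 2 * m).
  { replace (exp x - 1) with ((exp x - 1 - x) + x) by ring.
    eapply Rle_trans; [apply Rabs_triang|]. pose proof (Cmod_ge_0 w). fold m in H. nra. }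
  assert (M0 : 0 <= m) by apply Cmod_ge_0.
  eapply Rle_trans; [apply Cmod_le_re_im|].
  rewrite !re_minus, !im_minus.
  replace (Re (1 * w)) with x by (unfold x; rewrite re_scal_l; ring).
  replace (Im (1 * w)) with y by (unfold y; rewrite im_scal_l; ring).
  change (Re (cexp w)) with (exp x * cos y). change (Im (cexp w)) with (exp x * sin y).
  unfold cexp. simpl Re. simpl Im. unfold Re, Im; simpl.
  rewrite exp_0, cos_0, sin_0.
  replace (exp x * cos y - 1 * 1 - x)
    with ((exp x - 1 - x) * cos y + (1 + x) * (cos y - 1)) by ring.
  replace (exp x * sin y - 1 * 0 - y) with ((exp x - 1) * sin y + (sin y - y)) by ring.
  assert (A1 : Rabs ((exp x - 1 - x) * cos y + (1 + x) * (cos y - 1)) <= e' * m + 2 * (e' * m)).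
  { eapply Rle_trans; [apply Rabs_triang|]. rewrite !Rabs_mult.
    assert (Rabs (1 + x) <= 2).
    { eapply Rle_trans; [apply Rabs_triang|]. rewrite Rabs_R1. lra. }
    pose proof (Rabs_pos (exp x - 1 - x)). pose proof (Rabs_pos (cos y - 1)).
    pose proof (Rabs_pos (cos y)). pose proof (Rabs_pos (1 + x)).
    apply Rplus_le_compat; nra. }
  assert (A2 : Rabs ((exp x - 1) * sin y + (sin y - y)) <= 4 * (m * e') + e' * m).
  { eapply Rle_trans; [apply Rabs_triang|]. rewrite !Rabs_mult.
    pose proof (Rabs_pos (exp x - 1)). pose proof (Rabs_pos (sin y)).
    apply Rplus_le_compat; auto.
    apply Rle_trans with ((2 * m) * (2 * m)).
    - apply Rmult_le_compat; lra.
    - assert (m <= e') by lra. nra. }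
  assert (e' * m <= e / 8 * m) by nra. lra.
Qed.

Lemma cdiff_cexp z : cdiff cexp z.
Proof.
  apply (cdiff_congr (fun w => cexp z * cexp (w + - z))%C).
  - exists 1. split; [lra|]. intros w _. rewrite <- cexp_add. f_equal. ring.
  - apply cdiff_mult; [apply cdiff_const|].
    apply (cdiff_comp (fun w => w + - z)%C cexp).
    + apply cdiff_plus; [apply cdiff_id | apply cdiff_const].
    + replace (z + - z)%C with (RtoC 0) by ring. eexists. apply cderiv_cexp_0.
Qed.

(** The real part [p] of the principal root satisfies [2 p^2 = |w| + Re w], and
    the imaginary part [q] is then given by [2 p q = Im w]. *)
Definition csqrt (w : C) : C :=
  let p := sqrt ((Cmod w + Re w) / 2) in (p, Im w / (2 * p)).

Lemma csqrt_re_pos w : 0 < Re w -> 0 < Re (csqrt w).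
Proof.
  intros H. simpl. apply sqrt_lt_R0. pose proof (Cmod_ge_0 w). lra.
Qed.

Lemma csqrt_sqr w : 0 < Re w -> (csqrt w * csqrt w)%C = w.
Proof.
  intros H. pose proof (csqrt_re_pos w H) as Hp. unfold csqrt in *. simpl in Hp.
  set (p := sqrt ((Cmod w + Re w) / 2)) in *.
  assert (P2 : p * p = (Cmod w + Re w) / 2).
  { apply sqrt_sqrt. pose proof (Cmod_ge_0 w). lra. }
  pose proof (Cmod2_alt w) as M.
  apply injective_projections; simpl.
  - change (fst w) with (Re w).
    replace (p * p - Im w / (2 * p) * (Im w / (2 * p)))
      with (p * p - (Im w ^ 2) / (4 * (p * p))) by (field; lra).
    replace (Im w ^ 2) with (Cmod w ^ 2 - Re w ^ 2) by lra. rewrite P2.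
    pose proof (Cmod_ge_0 w). field. lra.
  - change (snd w) with (Im w). field. lra.
Qed.

Lemma Cmod_csqrt w : 0 < Re w -> Cmod w = Cmod (csqrt w) ^ 2.
Proof. intros H. rewrite <- (csqrt_sqr w H) at 1. rewrite Cmod_mult. ring. Qed.

Lemma re_pos_neq_0 w : 0 < Re w -> w <> 0.
Proof. intros H ->. simpl in H. lra. Qed.

Lemma re_le_Cmod_signed w : Re w <= Cmod w.
Proof. eapply Rle_trans; [apply Rle_abs | apply re_le_Cmod]. Qed.

Lemma near_re_pos z : 0 < Re z -> near z (fun w => 0 < Re w).
Proof.
  intros H. exists (Re z). split; auto. intros w Hw.
  pose proof (re_le_Cmod_signed (z - w)) as L. rewrite re_minus, Cmod_sub_sym in L. lra.
Qed.

Lemma csqrt_sub z w : 0 < Re z -> 0 < Re w ->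
  (csqrt w - csqrt z = / (csqrt w + csqrt z) * (w - z))%C.
Proof.
  intros Hz Hw. pose proof (csqrt_re_pos z Hz). pose proof (csqrt_re_pos w Hw).
  rewrite <- (csqrt_sqr z Hz) at 3. rewrite <- (csqrt_sqr w Hw) at 3.
  field. apply re_pos_neq_0. rewrite re_plus. lra.
Qed.

Lemma cont_csqrt z : 0 < Re z -> cont csqrt z.
Proof.
  intros Hz e He. pose proof (csqrt_re_pos z Hz) as Hp.
  generalize (near_and _ _ _ (near_re_pos z Hz) (cont_id z (e * Re (csqrt z)) ltac:(nra))).
  apply near_mono. intros w [H1 H2]. pose proof (csqrt_re_pos w H1).
  rewrite csqrt_sub by auto.
  assert (Hs : Re (csqrt z) <= Cmod (csqrt w + csqrt z)).
  { eapply Rle_trans; [|apply re_le_Cmod_signed]. rewrite re_plus. lra. }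
  assert (Hn : (csqrt w + csqrt z)%C <> 0) by (apply Cmod_gt_0; lra).
  rewrite Cmod_mult, Cmod_inv by auto.
  apply (Rmult_lt_reg_l (Cmod (csqrt w + csqrt z))); [lra|].
  rewrite <- Rmult_assoc, Rinv_r, Rmult_1_l by lra. nra.
Qed.

Lemma cdiff_csqrt z : 0 < Re z -> cdiff csqrt z.
Proof.
  intros Hz. eexists. exists (fun w => / (csqrt w + csqrt z))%C. repeat split.
  - apply cont_finv.
    + apply cont_plus; [now apply cont_csqrt | apply cont_const].
    + apply re_pos_neq_0. rewrite re_plus. pose proof (csqrt_re_pos z Hz). lra.
  - generalize (near_re_pos z Hz). apply near_mono. intros w Hw. now apply csqrt_sub.
Qed.

(** * The Cauchy-Goursat theorem on rectangles *)

Definition curve_cont (g : R -> C) (x : R) : Prop :=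
  forall e, 0 < e -> exists d, 0 < d /\ forall y, Rabs (y - x) < d -> Cmod (g y - g x) < e.

Definition ex_CInt (g : R -> C) (a b : R) := @ex_RInt C_R_CompleteNormedModule g a b.
Definition CInt (g : R -> C) (a b : R) : C := @RInt C_R_CompleteNormedModule g a b.

Lemma ex_CInt_cont g a b : (forall x, Rmin a b <= x <= Rmax a b -> curve_cont g x) -> ex_CInt g a b.
Proof.
  intros H. apply ex_RInt_continuous. intros x Hx P [e HP].
  destruct (H x Hx e (cond_pos e)) as [d [Hd Hy]].
  exists (mkposreal d Hd). intros y By. apply HP.
  apply C_NormedModule_mixin_compat1. apply Hy. exact By.
Qed.

Lemma CInt_ext g h a b : (forall x, Rmin a b < x < Rmax a b -> g x = h x) ->
  CInt g a b = CInt h a b.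
Proof. intros H. unfold CInt. apply (@RInt_ext C_R_CompleteNormedModule). exact H. Qed.

Lemma CInt_minus g h a b : ex_CInt g a b -> ex_CInt h a b ->
  CInt (fun x => g x - h x)%C a b = (CInt g a b - CInt h a b)%C.
Proof. intros Hg Hh. apply (@RInt_minus C_R_CompleteNormedModule); auto. Qed.

Lemma ex_CInt_minus g h a b : ex_CInt g a b -> ex_CInt h a b ->
  ex_CInt (fun x => g x - h x)%C a b.
Proof. intros Hg Hh. apply (@ex_RInt_minus C_R_CompleteNormedModule); auto. Qed.

Lemma CInt_Chasles g a b c : ex_CInt g a b -> ex_CInt g b c ->
  (CInt g a b + CInt g b c)%C = CInt g a c.
Proof. intros H1 H2. apply (@RInt_Chasles C_R_CompleteNormedModule); auto. Qed.

Lemma CInt_swap g a b : ex_CInt g a b -> CInt g b a = (- CInt g a b)%C.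
Proof. intros H. symmetry. now apply (@opp_RInt_swap C_R_CompleteNormedModule). Qed.

Lemma CInt_approx g a b k M : ex_CInt g a b ->
  (forall x, Rmin a b <= x <= Rmax a b -> Cmod (g x - k) <= M) ->
  Cmod (CInt g a b - RtoC (b - a) * k) <= Rabs (b - a) * M.
Proof.
  intros Hg HM. rewrite Cmod_norm.
  refine (@norm_RInt_le_const_abs C_R_CompleteNormedModule (fun x => g x - k)%C a b _ M _ _).
  - intros x Hx. specialize (HM x Hx). now rewrite Cmod_norm in HM.
  - apply (@is_RInt_minus C_R_CompleteNormedModule g (fun _ => k)).
    + now apply (@RInt_correct C_R_CompleteNormedModule).
    + rewrite <- scal_R_Cmult. apply (@is_RInt_const C_R_CompleteNormedModule).
Qed.

Lemma Cmod_hor x y c : Cmod ((y, c) - (x, c)) = Rabs (y - x).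
Proof.
  replace ((y, c) - (x, c))%C with (RtoC (y - x)); [apply Cmod_R|].
  apply injective_projections; simpl; ring.
Qed.

Lemma Cmod_ver x y c : Cmod ((c, y) - (c, x)) = Rabs (y - x).
Proof.
  replace ((c, y) - (c, x))%C with (Ci * RtoC (y - x))%C.
  - rewrite Cmod_mult, Cmod_Ci, Cmod_R. ring.
  - apply injective_projections; simpl; ring.
Qed.

Lemma curve_cont_hor f x c : cont f (x, c) -> curve_cont (fun x => f (x, c)) x.
Proof.
  intros H e He. destruct (H e He) as [d [Hd Hw]]. exists d. split; auto.
  intros y Hy. apply Hw. now rewrite Cmod_hor.
Qed.

Lemma curve_cont_ver f x c : cont f (c, x) -> curve_cont (fun y => f (c, y)) x.
Proof.
  intros H e He. destruct (H e He) as [d [Hd Hw]]. exists d. split; auto.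
  intros y Hy. apply Hw. now rewrite Cmod_ver.
Qed.

Lemma nested_intervals (a b : nat -> R) :
  (forall n, a n <= a (S n)) -> (forall n, b (S n) <= b n) -> (forall n, a n <= b n) ->
  exists p, forall n, a n <= p <= b n.
Proof.
  intros Ha Hb Hab.
  assert (Ma : forall n m, (n <= m)%nat -> a n <= a m).
  { intros n m L. induction L; [lra | specialize (Ha m); lra]. }
  assert (Mb : forall n m, (n <= m)%nat -> b m <= b n).
  { intros n m L. induction L; [lra | specialize (Hb m); lra]. }
  assert (AB : forall n m, a n <= b m).
  { intros n m. destruct (Nat.le_ge_cases n m) as [L|L].
    - specialize (Ma _ _ L). specialize (Hab m). lra.
    - specialize (Mb _ _ L). specialize (Hab n). lra. }
  destruct (completeness (fun x => exists n, x = a n)) as [p [P1 P2]].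
  - exists (b O). intros x [n ->]. apply AB.
  - exists (a O). now exists O.
  - exists p. intros n. split.
    + apply P1. now exists n.
    + apply P2. intros x [m ->]. apply AB.
Qed.

(** Opposite edges share one integral: when [f] is affine both integrands are
    constants, and the two terms visibly cancel. *)
Definition boundary_int (f : C -> C) (a b c d : R) : C :=
  (CInt (fun x => f (x, c) - f (x, d)) a b + Ci * CInt (fun y => f (b, y) - f (a, y)) c d)%C.

Definition cont_rect f a b c d :=
  forall x y, a <= x <= b -> c <= y <= d -> cont f (x, y).

Lemma ex_CInt_hor f a b c d x1 x2 y : cont_rect f a b c d ->
  a <= x1 <= x2 -> x2 <= b -> c <= y <= d -> ex_CInt (fun x => f (x, y)) x1 x2.
Proof.
  intros H H1 H2 H3. apply ex_CInt_cont. intros x. rewrite Rmin_left, Rmax_right by lra.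
  intros Hx. apply curve_cont_hor, H; lra.
Qed.

Lemma ex_CInt_ver f a b c d y1 y2 x : cont_rect f a b c d ->
  c <= y1 <= y2 -> y2 <= d -> a <= x <= b -> ex_CInt (fun y => f (x, y)) y1 y2.
Proof.
  intros H H1 H2 H3. apply ex_CInt_cont. intros y. rewrite Rmin_left, Rmax_right by lra.
  intros Hy. apply curve_cont_ver, H; lra.
Qed.

Ltac solve_ex_CInt H :=
  match goal with
  | |- ex_CInt (fun x => _ (x, _)) _ _ => apply (ex_CInt_hor _ _ _ _ _ _ _ _ H)
  | |- ex_CInt (fun y => _ (_, y)) _ _ => apply (ex_CInt_ver _ _ _ _ _ _ _ _ H)
  end; lra.

Lemma boundary_int_edges f a b c d : cont_rect f a b c d -> a <= b -> c <= d ->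
  boundary_int f a b c d = (CInt (fun x => f (x, c)) a b - CInt (fun x => f (x, d)) a b
    + Ci * (CInt (fun y => f (b, y)) c d - CInt (fun y => f (a, y)) c d))%C.
Proof.
  intros H Hab Hcd. unfold boundary_int.
  rewrite (CInt_minus (fun x => f (x, c)) (fun x => f (x, d))) by solve_ex_CInt H.
  rewrite (CInt_minus (fun y => f (b, y)) (fun y => f (a, y))) by solve_ex_CInt H.
  reflexivity.
Qed.

Lemma cont_rect_sub f a b c d a' b' c' d' : cont_rect f a b c d ->
  a <= a' -> b' <= b -> c <= c' -> d' <= d -> cont_rect f a' b' c' d'.
Proof. intros H ? ? ? ? x y ? ?. apply H; lra. Qed.

Lemma boundary_int_quarters f a b c d : cont_rect f a b c d -> a <= b -> c <= d ->
  let m := (a + b) / 2 in let n := (c + d) / 2 in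
  boundary_int f a b c d = (boundary_int f a m c n + boundary_int f m b c n + boundary_int f a m n d + boundary_int f m b n d)%C.
Proof.
  intros H Hab Hcd m n. 
  assert (a <= m <= b) by (unfold m; lra). assert (c <= n <= d) by (unfold n; lra).
  rewrite !boundary_int_edges; try lra; try (apply (cont_rect_sub _ _ _ _ _ _ _ _ _ H); lra).
  rewrite <- (CInt_Chasles (fun x => f (x, c)) a m b) by solve_ex_CInt H.
  rewrite <- (CInt_Chasles (fun x => f (x, d)) a m b) by solve_ex_CInt H.
  rewrite <- (CInt_Chasles (fun y => f (a, y)) c n d) by solve_ex_CInt H.
  rewrite <- (CInt_Chasles (fun y => f (b, y)) c n d) by solve_ex_CInt H.
  ring.
Qed.

Lemma Rle_0_of_small x M : 0 <= M -> (forall e, 0 < e -> x <= e * M) -> x <= 0.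
Proof.
  intros HM H. destruct (Rle_or_lt x 0) as [|Hx]; auto.
  specialize (H (x / (2 * (M + 1)))). 
  assert (0 < x / (2 * (M + 1))) by (apply Rdiv_lt_0_compat; lra).
  specialize (H H0). 
  assert (x / (2 * (M + 1)) * (2 * (M + 1)) = x) by (field; lra). nra.
Qed.

(** The affine part of [f] at [(p, q)] has zero boundary integral, so only the
    approximation error remains. It is at most [e * s] in modulus, [s] being the
    sum of the two side lengths, and the boundary has length [2 * s]. *)
Lemma boundary_int_local f a b c d p q e :
  cont_rect f a b c d -> a <= p <= b -> c <= q <= d ->
  (exists l, forall x y, a <= x <= b -> c <= y <= d ->
     Cmod (f (x, y) - f (p, q) - l * ((x, y) - (p, q))) <= e * Cmod ((x, y) - (p, q))) ->
  0 < e ->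
  Cmod (boundary_int f a b c d) <= 2 * e * (b - a + (d - c)) ^ 2.
Proof.
  intros H Hp Hq [l Hl] He. unfold boundary_int.
  set (s := b - a + (d - c)).
  assert (HC : forall x y, a <= x <= b -> c <= y <= d -> Cmod ((x, y) - (p, q)) <= s).
  { intros x y Hx Hy. eapply Rle_trans; [apply Cmod_le_re_im|].
    rewrite re_minus, im_minus. simpl. unfold s.
    apply Rplus_le_compat; apply Rabs_le; lra. }
  assert (HD : forall z w : C, a <= fst z <= b -> c <= snd z <= d -> a <= fst w <= b -> c <= snd w <= d ->
     Cmod (f z - f w - l * (z - w)) <= 2 * e * s).
  { intros [x y] [x' y'] Hx Hy Hx' Hy'. simpl in *.
    replace (f (x, y) - f (x', y') - l * ((x, y) - (x', y')))%C
     with ((f (x, y) - f (p, q) - l * ((x, y) - (p, q)))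
           - (f (x', y') - f (p, q) - l * ((x', y') - (p, q))))%C by ring.
    eapply Rle_trans; [apply Cmod_triangle_minus|].
    pose proof (Hl x y Hx Hy); pose proof (Hl x' y' Hx' Hy').
    pose proof (HC x y Hx Hy); pose proof (HC x' y' Hx' Hy'). nra. }
  pose proof (CInt_approx (fun x => f (x, c) - f (x, d))%C a b (l * (- Ci * RtoC (d - c)))%C (2 * e * s)) as A1.
  pose proof (CInt_approx (fun y => f (b, y) - f (a, y))%C c d (l * RtoC (b - a))%C (2 * e * s)) as A2.
  assert (B1 : ex_CInt (fun x => f (x, c) - f (x, d))%C a b) by (apply (ex_CInt_minus (fun x => f (x, c)) (fun x => f (x, d))); solve_ex_CInt H).
  assert (B2 : ex_CInt (fun y => f (b, y) - f (a, y))%C c d) by (apply (ex_CInt_minus (fun y => f (b, y)) (fun y => f (a, y))); solve_ex_CInt H).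
  specialize (A1 B1). specialize (A2 B2).
  rewrite Rmin_left, Rmax_right in A1 by lra. rewrite Rmin_left, Rmax_right in A2 by lra.
  rewrite Rabs_pos_eq in A1 by lra. rewrite Rabs_pos_eq in A2 by lra.
  match type of A1 with ?P -> _ => assert (Q1 : P) end.
  { intros x Hx. replace (- Ci * RtoC (d - c))%C with ((x, c) - (x, d))%C.
    - apply HD; simpl; lra.
    - apply injective_projections; simpl; ring. }
  match type of A2 with ?P -> _ => assert (Q2 : P) end.
  { intros y Hy. replace (RtoC (b - a))%C with ((b, y) - (a, y))%C.
    - apply HD; simpl; lra.
    - apply injective_projections; simpl; ring. }
  specialize (A1 Q1). specialize (A2 Q2).
  set (I1 := CInt _ a b) in *. set (I2 := CInt _ c d) in *.
  replace (I1 + Ci * I2)%C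
    with ((I1 - RtoC (b - a) * (l * (- Ci * RtoC (d - c)))) +
          Ci * (I2 - RtoC (d - c) * (l * RtoC (b - a))))%C by ring.
  eapply Rle_trans; [apply Cmod_triangle|]. rewrite Cmod_mult, Cmod_Ci.
  unfold s in *. nra.
Qed.

Definition rect := ((R * R) * (R * R))%type.
Definition rect_left (r : rect) := fst (fst r).
Definition rect_right (r : rect) := snd (fst r).
Definition rect_bottom (r : rect) := fst (snd r).
Definition rect_top (r : rect) := snd (snd r).

Definition rect_wf (r : rect) := rect_left r <= rect_right r /\ rect_bottom r <= rect_top r.

Definition rect_boundary_int (f : C -> C) (r : rect) := boundary_int f (rect_left r) (rect_right r) (rect_bottom r) (rect_top r).
Definition rect_size (r : rect) := rect_right r - rect_left r + (rect_top r - rect_bottom r).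

Definition bad (f : C -> C) (e : R) (r : rect) : Prop :=
  e * rect_size r ^ 2 < Cmod (rect_boundary_int f r).

Definition bad_dec f e r : {bad f e r} + {~ bad f e r} := Rlt_dec _ _.

(** The fourth quarter is the default: [quarter_bad] shows that it is bad when
    the other three are not. *)
Definition quarter (f : C -> C) (e : R) (r : rect) : rect :=
  let m := (rect_left r + rect_right r) / 2 in let n := (rect_bottom r + rect_top r) / 2 in
  let r1 := ((rect_left r, m), (rect_bottom r, n)) in
  let r2 := ((m, rect_right r), (rect_bottom r, n)) in
  let r3 := ((rect_left r, m), (n, rect_top r)) in
  let r4 := ((m, rect_right r), (n, rect_top r)) in
  if bad_dec f e r1 then r1 else if bad_dec f e r2 then r2
  else if bad_dec f e r3 then r3 else r4.

(** Halving the size divides the threshold by four, and the four boundary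
    integrals add up: a bad rectangle cannot have four quarters that are not bad. *)
Lemma quarter_bad f e r : rect_wf r -> cont_rect f (rect_left r) (rect_right r) (rect_bottom r) (rect_top r) ->
  bad f e r -> bad f e (quarter f e r).
Proof.
  destruct r as [[a b] [c d]]. intros [Hab Hcd] H B.
  unfold quarter, rect_left, rect_right, rect_top, rect_bottom in *; simpl fst in *; simpl snd in *.
  set (m := (a + b) / 2). set (n := (c + d) / 2). cbv zeta.
  destruct (bad_dec _ _ _) as [|N1]; [assumption|].
  destruct (bad_dec _ _ _) as [|N2]; [assumption|].
  destruct (bad_dec _ _ _) as [|N3]; [assumption|].
  apply Rnot_le_lt. intros N4. apply Rnot_lt_le in N1, N2, N3.
  pose proof (boundary_int_quarters f a b c d H Hab Hcd) as Q. fold m n in Q. cbv zeta in Q.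
  unfold bad, rect_boundary_int, rect_size, rect_left, rect_right, rect_top, rect_bottom in *; simpl fst in *; simpl snd in *.
  rewrite Q in B.
  set (s := b - a + (d - c)) in *.
  replace (m - a + (n - c)) with (s / 2) in N1 by (unfold s, m, n; field).
  replace (b - m + (n - c)) with (s / 2) in N2 by (unfold s, m, n; field).
  replace (m - a + (d - n)) with (s / 2) in N3 by (unfold s, m, n; field).
  replace (b - m + (d - n)) with (s / 2) in N4 by (unfold s, m, n; field).
  assert (Cmod (boundary_int f a m c n + boundary_int f m b c n + boundary_int f a m n d + boundary_int f m b n d) <=
     Cmod (boundary_int f a m c n) + Cmod (boundary_int f m b c n) + Cmod (boundary_int f a m n d) + Cmod (boundary_int f m b n d)).
  { eapply Rle_trans; [apply Cmod_triangle|]. apply Rplus_le_compat_r.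
    eapply Rle_trans; [apply Cmod_triangle|]. apply Rplus_le_compat_r. apply Cmod_triangle. }
  replace ((s / 2) ^ 2) with (s ^ 2 / 4) in * by field. lra.
Qed.

Lemma quarter_geom f e r : rect_wf r -> let r' := quarter f e r in
  rect_left r <= rect_left r' /\ rect_right r' <= rect_right r /\
  rect_bottom r <= rect_bottom r' /\ rect_top r' <= rect_top r /\ rect_wf r' /\ rect_size r' = rect_size r / 2.
Proof.
  destruct r as [[a b] [c d]]. intros [Hab Hcd]. unfold quarter.
  repeat destruct (bad_dec _ _ _);
    unfold rect_wf, rect_size, rect_left, rect_right, rect_top, rect_bottom in *; simpl fst in *; simpl snd in *;
    cbv zeta; simpl fst; simpl snd; repeat split; lra.
Qed.

(** Goursat's bisection: bad rectangles nested in one another shrink to a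
    point, where differentiability contradicts badness by [boundary_int_local]. *)
Lemma boundary_int_small f e a b c d : 0 < e -> a <= b -> c <= d ->
  (forall x y, a <= x <= b -> c <= y <= d -> cdiff f (x, y)) ->
  Cmod (boundary_int f a b c d) <= e * (b - a + (d - c)) ^ 2.
Proof.
  intros He Hab Hcd Hf. apply Rnot_lt_le. intros B.
  set (s := b - a + (d - c)) in *.
  set (r := fix r (n : nat) : rect :=
    match n with O => ((a, b), (c, d)) | S n => quarter f e (r n) end).
  assert (I : forall n, rect_wf (r n) /\ bad f e (r n) /\
     a <= rect_left (r n) /\ rect_right (r n) <= b /\ c <= rect_bottom (r n) /\ rect_top (r n) <= d /\
     rect_size (r n) = s / 2 ^ n).
  { induction n as [|n (W & Bn & L1 & L2 & L3 & L4 & E)].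
    - change (r O) with (((a, b), (c, d)) : rect).
      unfold rect_wf, bad, rect_boundary_int, rect_size, rect_left, rect_right, rect_bottom, rect_top; simpl fst; simpl snd.
      fold s. simpl (2 ^ 0). repeat split; try lra.
    - destruct (quarter_geom f e (r n) W) as (G1 & G2 & G3 & G4 & G5 & G6).
      change (r (S n)) with (quarter f e (r n)).
      split; [assumption|]. split.
      + apply quarter_bad; auto. intros x y Hx Hy. apply cdiff_cont, Hf; lra.
      + rewrite G6, E. simpl pow.
        assert (2 ^ n <> 0) by (apply pow_nonzero; lra).
        repeat split; try lra; field; auto. }
  assert (G : forall n, rect_left (r n) <= rect_left (r (S n)) /\ rect_right (r (S n)) <= rect_right (r n) /\
    rect_bottom (r n) <= rect_bottom (r (S n)) /\ rect_top (r (S n)) <= rect_top (r n)).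
  { intros n. destruct (I n) as [W _]. destruct (quarter_geom f e (r n) W) as (G1 & G2 & G3 & G4 & _).
    repeat split; assumption. }
  destruct (nested_intervals (fun n => rect_left (r n)) (fun n => rect_right (r n))) as [p Hp];
    [ apply G | apply G | apply I |].
  destruct (nested_intervals (fun n => rect_bottom (r n)) (fun n => rect_top (r n))) as [q Hq];
    [ apply G | apply G | apply I |].
  destruct (Hf p q) as [l Hl].
  { exact (Hp O). }
  { exact (Hq O). }
  destruct (proj1 (cderiv_eps _ _ _) Hl (e / 2) ltac:(lra)) as [dl [Hdl Hw]].
  assert (exists n, s / 2 ^ n < dl) as [n Hn].
  { destruct (pow_lt_1_zero (/ 2) ltac:(rewrite Rabs_pos_eq; lra) (dl / (s + 1))) as [n Hn].
    - apply Rdiv_lt_0_compat; unfold s; lra.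
    - exists n. specialize (Hn n (Nat.le_refl n)). rewrite Rabs_pos_eq in Hn by (apply pow_le; lra).
      rewrite pow_inv in Hn. unfold Rdiv.
      assert (s * / 2 ^ n <= (s + 1) * / 2 ^ n).
      { apply Rmult_le_compat_r; [|lra]. apply Rlt_le, Rinv_0_lt_compat, pow_lt; lra. }
      assert ((s + 1) * (dl / (s + 1)) = dl) by (field; unfold s; lra).
      assert (0 < s + 1) by (unfold s; lra). nra. }
  destruct (I n) as ([W1 W2] & Bn & L1 & L2 & L3 & L4 & E).
  specialize (Hp n). specialize (Hq n). simpl in Hp, Hq.
  unfold bad in Bn. apply (Rlt_not_le _ _ Bn).
  replace e with (2 * (e / 2)) at 1 by field.
  apply (boundary_int_local f _ _ _ _ p q); try lra.
  - intros x y Hx Hy. apply cdiff_cont, Hf; lra.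
  - exists l. intros x y Hx Hy. apply Hw.
    eapply Rle_lt_trans; [apply Cmod_le_re_im|]. rewrite re_minus, im_minus. simpl.
    apply Rle_lt_trans with (s / 2 ^ n); [|assumption].
    rewrite <- E. unfold rect_size. apply Rplus_le_compat; apply Rabs_le; lra.
Qed.

Lemma goursat f a b c d : a <= b -> c <= d ->
  (forall x y, a <= x <= b -> c <= y <= d -> cdiff f (x, y)) -> boundary_int f a b c d = 0.
Proof.
  intros Hab Hcd Hf. apply Cmod_eq_0. apply Rle_antisym; [|apply Cmod_ge_0].
  apply (Rle_0_of_small _ ((b - a + (d - c)) ^ 2)).
  - apply pow2_ge_0.
  - intros e He. now apply boundary_int_small.
Qed.

(** * Mean values over circles and the Schwarz-Pick inequality *)

(** For [g = q o cexp] this is the integral of [q] in the angle over the circle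
    of radius [exp u]. *)
Definition vertical_int (g : C -> C) (u : R) : C := CInt (fun y => g (u, y)) 0 (2 * PI).

Lemma two_PI_pos : 0 < 2 * PI.
Proof. pose proof PI_RGT_0. lra. Qed.

Lemma ex_vertical_int g u : (forall y, cont g (u, y)) -> ex_CInt (fun y => g (u, y)) 0 (2 * PI).
Proof. intros H. apply ex_CInt_cont. intros y _. now apply curve_cont_ver. Qed.

(** In the boundary integral of the rectangle between the abscissas [u] and
    [v], the horizontal edges cancel by periodicity. *)
Lemma vertical_int_const g u v : u <= v ->
  (forall x y, u <= x <= v -> cdiff g (x, y)) ->
  (forall x, g (x, 2 * PI) = g (x, 0)) -> vertical_int g u = vertical_int g v.
Proof.
  intros Huv Hg Hp. pose proof two_PI_pos as HP.
  pose proof (goursat g u v 0 (2 * PI) Huv ltac:(lra) ltac:(intros; now apply Hg)) as G.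
  unfold boundary_int in G.
  rewrite (CInt_minus (fun y => g (v, y)) (fun y => g (u, y))) in G
    by (apply ex_vertical_int; intros; apply cdiff_cont, Hg; lra).
  rewrite (CInt_ext _ (fun _ => RtoC 0)) in G by (intros; rewrite Hp; ring).
  replace (CInt (fun _ => RtoC 0) u v) with (RtoC 0) in G.
  2:{ unfold CInt. rewrite (@RInt_const C_R_CompleteNormedModule).
      symmetry. apply (@scal_zero_r R_AbsRing C_R_ModuleSpace). }
  fold (vertical_int g v) (vertical_int g u) in G.
  apply Ceq_minus.
  replace (vertical_int g u - vertical_int g v)%C with (Ci * (0 + Ci * (vertical_int g v - vertical_int g u)))%C.
  - rewrite G. ring.
  - transitivity ((Ci * Ci) * (vertical_int g v - vertical_int g u))%C; [ring|].
    replace (Ci * Ci)%C with (- RtoC 1)%C; [ring|].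
    apply injective_projections; simpl; ring.
Qed.

Lemma cont_2d g u y (p : C -> R) :
  (forall z w, Rabs (p z - p w) <= Cmod (z - w)) ->
  cont g (u, y) -> continuity_2d_pt (fun y x => p (g (x, y))) y u.
Proof.
  intros Hp H e. destruct (H e (cond_pos e)) as [d [Hd Hw]].
  exists (mkposreal (d / 2) ltac:(lra)). simpl. intros y' x' Hy Hx.
  eapply Rle_lt_trans; [apply Hp|]. apply Hw.
  eapply Rle_lt_trans; [apply Cmod_le_re_im|]. rewrite re_minus, im_minus. simpl. lra.
Qed.

Lemma vertical_int_approx g u k M : (forall y, cont g (u, y)) ->
  (forall y, Cmod (g (u, y) - k) <= M) -> Cmod (vertical_int g u - RtoC (2 * PI) * k) <= 2 * PI * M.
Proof.
  intros Hc HM. pose proof two_PI_pos.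
  pose proof (CInt_approx (fun y => g (u, y)) 0 (2 * PI) k M (ex_vertical_int g u Hc) (fun y _ => HM y)) as A.
  rewrite Rminus_0_r, Rabs_pos_eq in A by lra. exact A.
Qed.

Lemma vertical_int_cont g U u : u < U -> (forall x y, x < U -> cont g (x, y)) -> curve_cont (vertical_int g) u.
Proof.
  intros Hu Hc e He. pose proof two_PI_pos as HP.
  set (e' := mkposreal (e / (2 * PI) / 4) ltac:(apply Rdiv_lt_0_compat; [apply Rdiv_lt_0_compat|]; lra)).
  destruct (uniform_continuity_2d_1d (fun y x => Re (g (x, y))) 0 (2 * PI) u) with (eps := e')
    as [d1 H1].
  { intros y _. apply cont_2d; [|now apply Hc]. intros. rewrite <- re_minus. apply re_le_Cmod. }
  destruct (uniform_continuity_2d_1d (fun y x => Im (g (x, y))) 0 (2 * PI) u) with (eps := e')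
    as [d2 H2].
  { intros y _. apply cont_2d; [|now apply Hc]. intros. rewrite <- im_minus. apply im_le_Cmod. }
  exists (Rmin (U - u) (Rmin d1 d2)). split.
  { pose proof (cond_pos d1). pose proof (cond_pos d2).
    apply Rmin_glb_lt; [lra|]. apply Rmin_glb_lt; lra. }
  intros v Hv.
  assert (L1 := Rmin_l (U - u) (Rmin d1 d2)). assert (L2 := Rmin_r (U - u) (Rmin d1 d2)).
  assert (L3 := Rmin_l d1 d2). assert (L4 := Rmin_r d1 d2).
  apply Rabs_def2 in Hv. unfold vertical_int.
  rewrite <- (CInt_minus (fun y => g (v, y)) (fun y => g (u, y)))
    by (apply ex_vertical_int; intros; apply Hc; lra).
  pose proof (CInt_approx (fun y => g (v, y) - g (u, y))%C 0 (2 * PI) 0 (e / (2 * PI) / 2)) as A.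
  match type of A with ?P -> ?Q -> _ => assert (Q1 : P); [|assert (Q2 : Q)] end.
  - apply (ex_CInt_minus (fun y => g (v, y)) (fun y => g (u, y)));
      apply ex_vertical_int; intros; apply Hc; lra.
  - intros y Hy. rewrite Rmin_left, Rmax_right in Hy by lra.
    replace (g (v, y) - g (u, y) - 0)%C with (g (v, y) - g (u, y))%C by ring.
    eapply Rle_trans; [apply Cmod_le_re_im|]. rewrite re_minus, im_minus.
    pose proof (cond_pos d1). pose proof (cond_pos d2).
    assert (Z : Rabs (y - y) = 0) by (replace (y - y) with 0 by ring; apply Rabs_R0).
    specialize (H1 y u y v ltac:(lra) ltac:(lra) ltac:(lra) ltac:(lra) ltac:(lra)).
    specialize (H2 y u y v ltac:(lra) ltac:(lra) ltac:(lra) ltac:(lra) ltac:(lra)).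
    simpl in H1, H2. lra.
  - specialize (A Q1 Q2). rewrite Rminus_0_r, Rabs_pos_eq in A by lra.
    match type of A with Cmod (?I - _) <= _ => replace I with (I - RtoC (2 * PI) * 0)%C by ring end.
    eapply Rle_lt_trans; [exact A|].
    replace (2 * PI * (e / (2 * PI) / 2)) with (e / 2) by (field; lra). lra.
Qed.

(** The mean of [q] over the circle of radius [exp u] is constant in [u] on
    either side of [ln |a|], continuous at [ln |a|] as well, and tends to [q 0] as
    [u] tends to minus infinity: so [q 0] is the mean of [q] over the circle of
    radius [r]. *)
Lemma mean_value_bound q (a : C) r R : a <> 0 -> Cmod a < r < R ->
  (forall z, Cmod z < R -> cont q z) ->
  (forall z, Cmod z < R -> z <> a -> cdiff q z) ->
  (forall z, Cmod z = r -> Cmod (q z) <= 1) -> Cmod (q 0) <= 1.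
Proof.
  intros Ha Hr Hc Hd Hq. pose proof two_PI_pos as HP.
  apply Cmod_gt_0 in Ha.
  set (g := fun w => q (cexp w)).
  assert (Ex : forall x y, Cmod (cexp (x, y)) = exp x) by (intros; apply Cmod_cexp).
  assert (Gc : forall x y, x < ln R -> cont g (x, y)).
  { intros x y Hx. apply (cont_comp cexp q).
    - apply cdiff_cont, cdiff_cexp.
    - apply Hc. rewrite Ex. rewrite <- (exp_ln R) by lra. now apply exp_increasing. }
  assert (Gd : forall x y, x < ln R -> x <> ln (Cmod a) -> cdiff g (x, y)).
  { intros x y Hx Hn. apply (cdiff_comp cexp q).
    - apply cdiff_cexp.
    - apply Hd.
      + rewrite Ex. rewrite <- (exp_ln R) by lra. now apply exp_increasing.
      + intros E. apply Hn. rewrite <- E, Ex. now rewrite ln_exp. }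
  assert (Gp : forall x, g (x, 2 * PI) = g (x, 0)).
  { intros x. unfold g. f_equal. unfold cexp. simpl Re. simpl Im.
    rewrite cos_2PI, sin_2PI, cos_0, sin_0. reflexivity. }
  set (u0 := ln (Cmod a)) in *.
  assert (L1 : u0 < ln r) by (apply ln_increasing; lra).
  assert (L2 : ln r < ln R) by (apply ln_increasing; lra).
  assert (J1 : forall u, u0 < u <= ln r -> Cmod (vertical_int g u) <= 2 * PI).
  { intros u Hu. rewrite (vertical_int_const g u (ln r)); [| lra | intros; apply Gd; lra | exact Gp].
    replace (vertical_int g (ln r)) with (vertical_int g (ln r) - RtoC (2 * PI) * 0)%C by ring.
    rewrite <- (Rmult_1_r (2 * PI)) at 2. apply vertical_int_approx.
    - intros y. now apply Gc.
    - intros y. replace (g (ln r, y) - 0)%C with (g (ln r, y)) by ring.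
      apply Hq. rewrite Ex. apply exp_ln. lra. }
  (* The means just inside and just outside the circle through a are close, by
     continuity at ln |a|. *)
  assert (J2 : forall u e, u < u0 -> 0 < e -> Cmod (vertical_int g u) <= 2 * PI + e).
  { intros u e Hu He.
    destruct (vertical_int_cont g (ln R) u0 ltac:(lra) Gc (e / 2) ltac:(lra)) as [d [Pd H]].
    set (d' := Rmin (d / 2) (Rmin (ln r - u0) (u0 - u))).
    assert (0 < d') by (apply Rmin_glb_lt; [lra | apply Rmin_glb_lt; lra]).
    assert (d' <= d / 2) by apply Rmin_l.
    assert (d' <= ln r - u0) by (eapply Rle_trans; [apply Rmin_r | apply Rmin_l]).
    assert (d' <= u0 - u) by (eapply Rle_trans; [apply Rmin_r | apply Rmin_r]).
    rewrite (vertical_int_const g u (u0 - d')); [| lra | intros; apply Gd; lra | exact Gp].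
    pose proof (H (u0 - d') ltac:(apply Rabs_def1; lra)) as K1.
    pose proof (H (u0 + d') ltac:(apply Rabs_def1; lra)) as K2.
    pose proof (J1 (u0 + d') ltac:(lra)) as K3.
    pose proof (Cmod_triangle_sub (vertical_int g (u0 - d')) (vertical_int g u0)).
    pose proof (Cmod_triangle_sub (vertical_int g u0) (vertical_int g (u0 + d'))) as K4.
    rewrite Cmod_sub_sym in K4. lra. }
  assert (J3 : forall e, 0 < e -> Cmod (q 0) - 1 <= e * 2).
  { intros e He.
    destruct (Hc 0 ltac:(rewrite Cmod_0; lra) e He) as [d [Pd H]].
    set (u := Rmin (u0 - 1) (ln (d / 2))).
    assert (U1 : u <= u0 - 1) by apply Rmin_l.
    assert (U2 : exp u < d).
    { apply Rle_lt_trans with (d / 2); [|lra]. rewrite <- (exp_ln (d / 2)) by lra.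
      destruct (Rmin_r (u0 - 1) (ln (d / 2))) as [K|K].
      - left. now apply exp_increasing.
      - right. unfold u. now rewrite K. }
    pose proof (J2 u (2 * PI * e) ltac:(lra) ltac:(nra)) as K1.
    assert (K2 : Cmod (vertical_int g u - RtoC (2 * PI) * q 0) <= 2 * PI * e).
    { apply vertical_int_approx.
      - intros y. apply Gc. lra.
      - intros y. left. apply H. replace (cexp (u, y) - 0)%C with (cexp (u, y)) by ring.
        now rewrite Ex. }
    pose proof (Cmod_triangle_sub (RtoC (2 * PI) * q 0) (vertical_int g u)) as K3.
    rewrite Cmod_sub_sym in K3. rewrite Cmod_mult, Cmod_R, Rabs_pos_eq in K3 by lra.
    apply (Rmult_le_reg_l (2 * PI)); lra. }
  pose proof (Rle_0_of_small _ 2 ltac:(lra) J3). lra.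
Qed.

(** A point of the half-plane is at least as far from the mirror image
    [- Cconj A] of [A] in the imaginary axis as from [A] itself. *)
Lemma Cmod_le_conj A B : 0 < Re A -> 0 < Re B -> Cmod (B - A) <= Cmod (B + Cconj A).
Proof.
  intros HA HB. apply Rsqr_incr_0_var; [|apply Cmod_ge_0].
  rewrite !Rsqr_pow2, !Cmod2_alt, re_minus, im_minus, re_plus, im_plus, re_conj, im_conj. nra.
Qed.

(** The function [(f - f a) / (f + Cconj (f a))] is bounded by 1 and vanishes
    at [a]. Its quotient by the Blaschke factor that vanishes at [a] and has
    modulus 1 on the circle [|z - c| = r] is at most 1 on that circle, hence at the
    centre, by [mean_value_bound]; this is the inequality. *)
Lemma schwarz_pick_lt f c a r R : a <> c -> Cmod (a - c) < r < R ->
  (forall z, Cmod (z - c) < R -> cdiff f z /\ 0 < Re (f z)) ->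
  Cmod (f c - f a) * r <= Cmod (a - c) * Cmod (f c + Cconj (f a)).
Proof.
  intros Hac Hr Hf.
  set (al := (a - c)%C) in *. set (A := f a).
  assert (Hal : al <> 0) by now apply Cminus_eq_contra.
  pose proof (proj1 (Cmod_gt_0 _) Hal) as Hal0.
  assert (HA : 0 < Re A) by (apply Hf; fold al; lra).
  set (F := fun z => ((f (c + z) + - A) * / (f (c + z) + Cconj A))%C).
  assert (Hd : forall z, Cmod z < R -> 0 < Re (f (c + z)%C) /\ cdiff F z).
  { intros z Hz. destruct (Hf (c + z)%C) as [D P].
    { now replace (c + z - c)%C with z by ring. }
    split; auto.
    assert (Df : cdiff (fun z => f (c + z)%C) z).
    { apply (cdiff_comp (fun z => c + z)%C f); auto.
      apply cdiff_plus; [apply cdiff_const | apply cdiff_id]. }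
    apply cdiff_mult.
    - apply cdiff_plus; [exact Df | apply cdiff_const].
    - apply cdiff_finv.
      + apply cdiff_plus; [exact Df | apply cdiff_const].
      + apply re_pos_neq_0. rewrite re_plus, re_conj. lra. }
  assert (Hn : forall z, Cmod z < R -> (f (c + z) + Cconj A)%C <> 0).
  { intros z Hz. apply re_pos_neq_0. rewrite re_plus, re_conj. pose proof (proj1 (Hd z Hz)). lra. }
  assert (F1 : forall z, Cmod z < R -> Cmod (F z) <= 1).
  { intros z Hz. unfold F. pose proof (Hn z Hz) as N. rewrite Cmod_mult, Cmod_inv by auto.
    apply Cmod_gt_0 in N. apply (Rmult_le_reg_r (Cmod (f (c + z) + Cconj A)%C)); auto.
    rewrite Rmult_assoc, Rinv_l, Rmult_1_r, Rmult_1_l by lra.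
    apply Cmod_le_conj; auto. now apply Hd. }
  assert (F0 : F al = 0).
  { unfold F, al. replace (c + (a - c))%C with a by ring. fold A. ring. }
  destruct (Hd al ltac:(lra)) as [_ [l [phi [C1 [_ N1]]]]].
  (* The slope of F at al, that is F / (z - al) with its singularity removed. *)
  set (psi := fun z => if Ceq_dec z al then phi al else (F z / (z - al))%C).
  assert (Npsi : near al (fun z => phi z = psi z)).
  { revert N1. apply near_mono. intros z E. unfold psi.
    destruct (Ceq_dec z al) as [->|Hz]; auto.
    rewrite F0 in E. replace (F z - 0)%C with (F z) in E by ring. rewrite E. field.
    now apply Cminus_eq_contra. }
  assert (Dpsi : forall z, Cmod z < R -> z <> al -> cdiff psi z).
  { intros z Hz Hza. apply (cdiff_congr (fun w => F w * / (w + - al))%C).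
    - generalize (near_neq z al Hza). apply near_mono. intros w Hw. unfold psi.
      now destruct (Ceq_dec w al).
    - apply cdiff_mult; [now apply Hd|]. apply cdiff_finv.
      + apply cdiff_plus; [apply cdiff_id | apply cdiff_const].
      + now apply (Cminus_eq_contra z al). }
  (* On the circle of radius r one has |b z| = |z - al|, so psi * b is F divided by
     the Blaschke factor. *)
  set (b := fun z => ((RtoC (r * r) + - Cconj al * z) * RtoC (/ r))%C).
  assert (Db : forall z, cdiff b z).
  { intros z. apply cdiff_mult; [|apply cdiff_const]. apply cdiff_plus; [apply cdiff_const|].
    apply cdiff_mult; [apply cdiff_const | apply cdiff_id]. }
  assert (Bz : forall z, Cmod z = r -> Cmod (b z) = Cmod (z - al)).
  { intros z Hz. unfold b.
    replace (RtoC (r * r)) with (z * Cconj z)%C.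
    2:{ rewrite <- Cmod2_conj, Hz, RtoC_pow, RtoC_mult. ring. }
    replace (z * Cconj z + - Cconj al * z)%C with (z * Cconj (z - al))%C
      by (rewrite Cminus_conj; ring).
    rewrite !Cmod_mult, Cmod_conj, Cmod_R, Hz, Rabs_pos_eq.
    - field. lra.
    - left. apply Rinv_0_lt_compat. lra. }
  assert (Q : Cmod (psi 0 * b 0) <= 1).
  { apply (mean_value_bound (fun z => psi z * b z)%C al r R); auto.
    - intros z Hz. apply cont_mult; [|apply cdiff_cont, Db].
      destruct (Ceq_dec z al) as [->|Hza].
      + apply (cont_congr phi); auto.
      + apply cdiff_cont. auto.
    - intros z Hz Hza. apply cdiff_mult; auto.
    - intros z Hz. rewrite Cmod_mult, Bz by auto. unfold psi.
      destruct (Ceq_dec z al) as [->|Hza]; [lra|].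
      apply Cminus_eq_contra in Hza. rewrite Cmod_div by auto. apply Cmod_gt_0 in Hza.
      unfold Rdiv. rewrite Rmult_assoc, Rinv_l, Rmult_1_r by lra. apply F1. lra. }
  simpl in Q. unfold psi in Q. destruct (Ceq_dec 0 al) as [E|E]; [now elim Hal|].
  unfold b, F in Q. rewrite !Cmult_0_r in Q.
  replace (c + 0)%C with c in Q by ring.
  pose proof (Hn 0 ltac:(rewrite Cmod_0; lra)) as N. replace (c + 0)%C with c in N by ring.
  replace (_ / (0 - al) * _)%C with ((f c - A) * RtoC r / (- (f c + Cconj A) * al))%C in Q.
  2:{ rewrite RtoC_mult, RtoC_inv by lra. field. repeat split; auto.
      apply Cmod_gt_0. rewrite Cmod_R, Rabs_pos_eq; lra. }
  assert (N' : (- (f c + Cconj A))%C <> 0).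
  { apply Cmod_gt_0. rewrite Cmod_opp. now apply Cmod_gt_0. }
  rewrite Cmod_div in Q by (now apply Cmult_neq_0).
  rewrite !Cmod_mult, Cmod_opp, Cmod_R, Rabs_pos_eq in Q by lra.
  apply Cmod_gt_0 in N.
  assert (0 < Cmod (f c + Cconj A) * Cmod al) by nra.
  apply Rmult_le_compat_r with (r := Cmod (f c + Cconj A) * Cmod al) in Q; [|lra].
  unfold Rdiv in Q. rewrite Rmult_assoc, Rinv_l in Q by lra. lra.
Qed.

Lemma schwarz_pick f c a R : Cmod (a - c) < R ->
  (forall z, Cmod (z - c) < R -> cdiff f z /\ 0 < Re (f z)) ->
  Cmod (f c - f a) * R <= Cmod (a - c) * Cmod (f c + Cconj (f a)).
Proof.
  intros Hr Hf. destruct (Ceq_dec a c) as [->|Hac].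
  { replace (f c - f c)%C with (RtoC 0) by ring. replace (c - c)%C with (RtoC 0) by ring.
    rewrite Cmod_0. lra. }
  apply Rminus_le. pose proof (Cmod_ge_0 (f c - f a)).
  apply (Rle_0_of_small _ (Cmod (f c - f a))); [lra|].
  intros e He. 
  set (r := Rmax (R - e) ((R + Cmod (a - c)) / 2)).
  assert (R - e <= r) by apply Rmax_l.
  assert ((R + Cmod (a - c)) / 2 <= r) by apply Rmax_r.
  assert (r < R) by (apply Rmax_lub_lt; lra).
  pose proof (schwarz_pick_lt f c a r R Hac ltac:(lra) Hf). nra.
Qed.

(** * Primitives on the right half-plane, and curves *)

Section Primitive.
Variable f : C -> C.
Hypothesis f_diff : forall z, 0 < Re z -> cdiff f z.

Lemma ex_CInt_hor_half_plane y a b : 0 < a -> 0 < b -> ex_CInt (fun x => f (x, y)) a b.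
Proof.
  intros Ha Hb. apply ex_CInt_cont. intros x Hx. apply curve_cont_hor, cdiff_cont, f_diff. simpl.
  assert (0 < Rmin a b) by now apply Rmin_glb_lt. lra.
Qed.

Lemma ex_CInt_ver_half_plane x c d : 0 < x -> ex_CInt (fun y => f (x, y)) c d.
Proof. intros Hx. apply ex_CInt_cont. intros y _. now apply curve_cont_ver, cdiff_cont, f_diff. Qed.

(** Goursat's theorem with the corners in any order, so that the increments of
    a primitive can be computed without distinguishing the relative positions. *)
Lemma path_independence a b c d : 0 < a -> 0 < b ->
  (CInt (fun x => f (x, c)) a b + Ci * CInt (fun y => f (b, y)) c d =
   CInt (fun x => f (x, d)) a b + Ci * CInt (fun y => f (a, y)) c d)%C.
Proof.
  intros Ha Hb.
  assert (W : forall a b c d, 0 < a -> 0 < b -> a <= b -> c <= d ->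
    (CInt (fun x => f (x, c)) a b + Ci * CInt (fun y => f (b, y)) c d =
     CInt (fun x => f (x, d)) a b + Ci * CInt (fun y => f (a, y)) c d)%C).
  { clear a b c d Ha Hb. intros a b c d Ha Hb Hab Hcd.
    assert (D : forall x y, a <= x <= b -> c <= y <= d -> cdiff f (x, y))
      by (intros; apply f_diff; simpl; lra).
    pose proof (goursat f a b c d Hab Hcd D) as G.
    rewrite boundary_int_edges in G; auto; [|intros x y Hx Hy; now apply cdiff_cont, D].
    apply Ceq_minus. rewrite <- G. ring. }
  assert (W' : forall a b, 0 < a -> 0 < b -> a <= b ->
    (CInt (fun x => f (x, c)) a b + Ci * CInt (fun y => f (b, y)) c d =
     CInt (fun x => f (x, d)) a b + Ci * CInt (fun y => f (a, y)) c d)%C).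
  { clear a b Ha Hb. intros a b Ha Hb Hab. destruct (Rle_or_lt c d) as [Hcd|Hcd]; [now apply W|].
    rewrite (CInt_swap (fun y => f (b, y)) d c), (CInt_swap (fun y => f (a, y)) d c)
      by now apply ex_CInt_ver_half_plane.
    pose proof (W a b d c Ha Hb Hab ltac:(lra)) as E. 
    apply Ceq_minus. apply (proj1 (Ceq_minus _ _)) in E.
    transitivity (- RtoC 0)%C; [rewrite <- E|]; ring. }
  destruct (Rle_or_lt a b) as [Hab|Hab]; [now apply W'|].
  rewrite (CInt_swap (fun x => f (x, c)) b a), (CInt_swap (fun x => f (x, d)) b a)
    by now apply ex_CInt_hor_half_plane.
  pose proof (W' b a Hb Ha ltac:(lra)) as E.
  apply Ceq_minus. apply (proj1 (Ceq_minus _ _)) in E.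
  transitivity (- RtoC 0)%C; [rewrite <- E|]; ring.
Qed.

(** The integral of [f] from 1 to [z] along a vertical segment, then a
    horizontal one. *)
Definition half_plane_primitive (z : C) : C :=
  (CInt (fun x => f (x, Im z)) 1 (Re z) + Ci * CInt (fun y => f (1, y)) 0 (Im z))%C.

(** The base point disappears from increments, which are integrals along a
    path of two segments from [z] to [w]; closeness of [f] to [f z] on that path
    then gives [cderiv_primitive]. *)
Lemma primitive_increment z w : 0 < Re z -> 0 < Re w ->
  (half_plane_primitive w - half_plane_primitive z = CInt (fun x => f (x, Im w)) (Re z) (Re w)
    + Ci * CInt (fun y => f (Re z, y)) (Im z) (Im w))%C.
Proof.
  intros Hz Hw. unfold half_plane_primitive.
  rewrite <- (CInt_Chasles (fun x => f (x, Im w)) 1 (Re z) (Re w))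
    by (apply ex_CInt_hor_half_plane; lra).
  rewrite <- (CInt_Chasles (fun y => f (1, y)) 0 (Im z) (Im w))
    by (apply ex_CInt_ver_half_plane; lra).
  pose proof (path_independence 1 (Re z) (Im z) (Im w) ltac:(lra) Hz) as E.
  apply (proj1 (Ceq_minus _ _)) in E.
  apply Ceq_minus.
  transitivity (- RtoC 0)%C; [rewrite <- E|]; ring.
Qed.

Lemma cderiv_primitive z : 0 < Re z -> cderiv half_plane_primitive z (f z).
Proof.
  intros Hz. apply cderiv_eps. intros e He.
  destruct (cdiff_cont _ _ (f_diff z Hz) (e / 2) ltac:(lra)) as [d [Hd H]].
  exists (Rmin (d / 2) (Re z)). split; [apply Rmin_glb_lt; lra|].
  intros w Hw.
  assert (Hw1 : Cmod (w - z) < d / 2) by (eapply Rlt_le_trans; [exact Hw | apply Rmin_l]).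
  assert (Hw2 : Cmod (w - z) < Re z) by (eapply Rlt_le_trans; [exact Hw | apply Rmin_r]).
  pose proof (re_le_Cmod (w - z)) as Rw. pose proof (im_le_Cmod (w - z)) as Iw.
  rewrite re_minus in Rw. rewrite im_minus in Iw.
  assert (Hw0 : 0 < Re w).
  { pose proof (Rabs_def2 _ _ (Rle_lt_trans _ _ _ Rw Hw2)). lra. }
  rewrite primitive_increment by auto.
  assert (N : forall x y, Rabs (x - Re z) <= Rabs (Re w - Re z) ->
    Rabs (y - Im z) <= Rabs (Im w - Im z) -> Cmod (f (x, y) - f z) <= e / 2).
  { intros x y Hx Hy. left. apply H.
    eapply Rle_lt_trans; [apply Cmod_le_re_im|]. rewrite re_minus, im_minus. simpl. lra. }
  pose proof (CInt_approx (fun x => f (x, Im w)) (Re z) (Re w) (f z) (e / 2)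
    (ex_CInt_hor_half_plane _ _ _ Hz Hw0)) as A1.
  pose proof (CInt_approx (fun y => f (Re z, y)) (Im z) (Im w) (f z) (e / 2)
    (ex_CInt_ver_half_plane _ _ _ Hz)) as A2.
  assert (between : forall a b x, Rmin a b <= x <= Rmax a b -> Rabs (x - a) <= Rabs (b - a)).
  { intros a b x. unfold Rmin, Rmax. destruct (Rle_dec a b); intros ?.
    - rewrite !Rabs_pos_eq; lra.
    - rewrite !Rabs_left1; lra. }
  assert (Z : Rabs (Re z - Re z) <= Rabs (Re w - Re z)).
  { replace (Re z - Re z) with 0 by ring. rewrite Rabs_R0. apply Rabs_pos. }
  specialize (A1 (fun x Hx => N _ _ (between _ _ _ Hx) (Rle_refl _))).
  specialize (A2 (fun y Hy => N _ _ Z (between _ _ _ Hy))).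
  set (I1 := CInt (fun x => f (x, Im w)) (Re z) (Re w)) in *.
  set (I2 := CInt (fun y => f (Re z, y)) (Im z) (Im w)) in *.
  replace (I1 + Ci * I2 - f z * (w - z))%C
    with ((I1 - RtoC (Re w - Re z) * f z) + Ci * (I2 - RtoC (Im w - Im z) * f z))%C.
  - eapply Rle_trans; [apply Cmod_triangle|]. rewrite Cmod_mult, Cmod_Ci. nra.
  - replace (w - z)%C with (RtoC (Re w - Re z) + Ci * RtoC (Im w - Im z))%C; [ring|].
    apply injective_projections; simpl; unfold Re, Im; ring.
Qed.
End Primitive.

Definition curve_deriv (p : R -> C) (t : R) (v : C) : Prop :=
  forall e, 0 < e -> exists d, 0 < d /\ forall s, Rabs (s - t) < d ->
    Cmod (p s - p t - RtoC (s - t) * v) <= e * Rabs (s - t).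

Lemma curve_deriv_comp F p t l v : cderiv F (p t) l -> curve_deriv p t v -> curve_deriv (fun s => F (p s)) t (l * v)%C.
Proof.
  intros HF Hp e He. pose proof (Cmod_ge_0 v) as V0. pose proof (Cmod_ge_0 l) as L0.
  set (e1 := e / (2 * (Cmod v + 1))). set (e2 := Rmin 1 (e / (2 * (Cmod l + 1)))).
  assert (E1 : 0 < e1) by (apply Rdiv_lt_0_compat; lra).
  assert (E2 : 0 < e2) by (apply Rmin_glb_lt; [lra | apply Rdiv_lt_0_compat; lra]).
  destruct (proj1 (cderiv_eps _ _ _) HF e1 E1) as [d1 [D1 H1]].
  destruct (Hp e2 E2) as [d2 [D2 H2]].
  exists (Rmin d2 (d1 / (Cmod v + 1))). split.
  { apply Rmin_glb_lt; auto. apply Rdiv_lt_0_compat; lra. }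
  intros s Hs.
  assert (Hs1 : Rabs (s - t) < d2) by (eapply Rlt_le_trans; [exact Hs | apply Rmin_l]).
  assert (Hs2 : Rabs (s - t) < d1 / (Cmod v + 1)) by (eapply Rlt_le_trans; [exact Hs | apply Rmin_r]).
  specialize (H2 s Hs1). pose proof (Rabs_pos (s - t)) as A0. set (a := Rabs (s - t)) in *.
  assert (B2 : e2 <= 1) by apply Rmin_l.
  assert (B2' : e2 * (Cmod l + 1) <= e / 2).
  { apply Rle_trans with (e / (2 * (Cmod l + 1)) * (Cmod l + 1)).
    - apply Rmult_le_compat_r; [lra | apply Rmin_r].
    - right. field. lra. }
  assert (B1 : e1 * (Cmod v + 1) = e / 2) by (unfold e1; field; lra).
  assert (Hd : Cmod (p s - p t) <= (Cmod v + 1) * a).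
  { pose proof (Cmod_triangle_sub (p s - p t) (RtoC (s - t) * v)) as T.
    rewrite Cmod_mult, Cmod_R in T. fold a in T. nra. }
  assert (Hd1 : Cmod (p s - p t) < d1).
  { eapply Rle_lt_trans; [exact Hd|].
    replace d1 with ((Cmod v + 1) * (d1 / (Cmod v + 1))) by (field; lra).
    apply Rmult_lt_compat_l; lra. }
  specialize (H1 _ Hd1).
  replace (F (p s) - F (p t) - RtoC (s - t) * (l * v))%C
    with ((F (p s) - F (p t) - l * (p s - p t)) + l * (p s - p t - RtoC (s - t) * v))%C by ring.
  eapply Rle_trans; [apply Cmod_triangle|]. rewrite Cmod_mult.
  assert (Cmod l * Cmod (p s - p t - RtoC (s - t) * v) <= Cmod l * (e2 * a))
    by (apply Rmult_le_compat_l; auto).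
  assert (e1 * Cmod (p s - p t) <= e1 * ((Cmod v + 1) * a)) by (apply Rmult_le_compat_l; lra).
  nra.
Qed.

Lemma is_derive_re_curve p t v : curve_deriv p t v -> is_derive (fun s => Re (p s)) t (Re v).
Proof.
  intros H. apply is_derive_Reals. intros e He. destruct (H (e / 2) ltac:(lra)) as [d [Hd Hs]].
  exists (mkposreal d Hd). intros h Hh0 Hh. simpl in Hh.
  specialize (Hs (t + h)). replace (t + h - t) with h in Hs by ring. specialize (Hs Hh).
  pose proof (re_le_Cmod (p (t + h) - p t - RtoC h * v)) as B.
  rewrite !re_minus, re_scal_l in B.
  pose proof (Rabs_pos_lt h Hh0) as A0.
  replace ((Re (p (t + h)) - Re (p t)) / h - Re v)
    with ((Re (p (t + h)) - Re (p t) - h * Re v) / h) by (field; auto).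
  unfold Rdiv. rewrite Rabs_mult, Rabs_inv. 
  apply (Rmult_lt_reg_r (Rabs h)); auto. rewrite Rmult_assoc, Rinv_l, Rmult_1_r by lra.
  nra.
Qed.

Lemma cderiv_scal k z : cderiv (fun w => k * w)%C z k.
Proof.
  exists (fun _ => k). repeat split; [apply cont_const|]. exists 1. split; [lra|]. intros. ring.
Qed.

Lemma curve_deriv_line z k t : curve_deriv (fun s => z + RtoC s * k)%C t k.
Proof.
  intros e He. exists 1. split; [lra|]. intros s _.
  replace (z + RtoC s * k - (z + RtoC t * k) - RtoC (s - t) * k)%C with (RtoC 0).
  - rewrite Cmod_0. pose proof (Rabs_pos (s - t)). nra.
  - rewrite RtoC_minus. ring.
Qed.

Lemma increment_le (f g : R -> R) df dg a b : a <= b ->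
  (forall t, a <= t <= b -> is_derive f t (df t) /\ is_derive g t (dg t) /\ df t <= dg t) ->
  f b - f a <= g b - g a.
Proof.
  intros Hab H.
  destruct (MVT_gen (fun t => g t - f t) a b (fun t => dg t - df t)) as [c [Hc E]].
  - rewrite Rmin_left, Rmax_right by lra. intros x Hx.
    apply (@is_derive_minus R_AbsRing R_NormedModule g f); apply H; lra.
  - rewrite Rmin_left, Rmax_right by lra. intros x Hx. apply continuity_pt_filterlim.
    apply (@ex_derive_continuous R_AbsRing R_NormedModule (fun t => g t - f t)). exists (dg x - df x).
    apply (@is_derive_minus R_AbsRing R_NormedModule g f); apply H; lra.
  - rewrite Rmin_left, Rmax_right in Hc by lra.
    destruct (H c Hc) as [_ [_ L]]. nra.
Qed.

(** * Displacement along a trajectory *)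

(** With [v = p + i q], the real part of [v^3] is [p (2 Re (v^2) - |v|^2)]. It is
    close to [- p |v|^2] when [v^2] is almost imaginary, and otherwise the term in
    [Re (v^2)] compensates; the hypothesis says that [v^2] lies in the closed
    right half-plane. *)
Lemma half_cube_le v : Rabs (Im v) <= Re v -> 
  Cmod v ^ 3 / 2 <= - Re (v * (v * v)) + 2 * Cmod v * Re (v * v).
Proof.
  intros H. pose proof (Cmod2_alt v) as M. pose proof (Cmod_ge_0 v) as S0.
  rewrite !re_mult, !im_mult.
  set (s := Cmod v) in *. set (p := Re v) in *. set (q := Im v) in *.
  assert (P0 : 0 <= p) by (pose proof (Rabs_pos q); lra).
  assert (Q : q ^ 2 <= p ^ 2) by (rewrite <- (pow2_abs q); pose proof (Rabs_pos q); nra).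
  assert (S1 : s <= 2 * p) by nra.
  assert (S2 : p <= s) by nra.
  replace (- (p * (p * p - q * q) - q * (p * q + q * p)) + 2 * s * (p * p - q * q))
    with (p * s ^ 2 + 2 * (s - p) * (p ^ 2 - q ^ 2)) by (rewrite M; ring).
  assert (0 <= (s - p) * (p ^ 2 - q ^ 2)) by nra.
  assert (s ^ 3 / 2 <= p * s ^ 2) by nra. lra.
Qed.

Lemma re_csqrt_ge_im w : 0 < Re w -> Rabs (Im (csqrt w)) <= Re (csqrt w).
Proof.
  intros H. pose proof (csqrt_re_pos w H) as P. pose proof (csqrt_sqr w H) as E.
  assert (0 < Re (csqrt w * csqrt w)) by now rewrite E.
  rewrite re_mult in H0. rewrite <- (Rabs_pos_eq (Re (csqrt w))) by lra.
  apply Rsqr_le_abs_0. unfold Rsqr. lra.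
Qed.

(** Young's inequality, by cases on whether [s] exceeds [mu]. *)
Lemma sqr_le_cube mu s : 0 < mu -> 0 <= s -> s ^ 2 <= mu ^ 2 + s ^ 3 / mu.
Proof.
  intros Hm Hs. destruct (Rle_or_lt s mu) as [L|L].
  - assert (0 <= s ^ 3 / mu) by (apply Rle_mult_inv_pos; [apply pow_le|]; lra). nra.
  - assert (s ^ 2 <= s ^ 3 / mu); [|nra].
    apply (Rmult_le_reg_r mu); auto. unfold Rdiv. rewrite Rmult_assoc, Rinv_l by lra. nra.
Qed.

(** The point is that the right-hand side can be integrated along a trajectory
    with velocity [w = H (p t)]: [Re (csqrt w * w)] is the derivative of the real
    part of a primitive of [csqrt o H], and [Re w] that of the abscissa. *)
Lemma speed_bound w k mu : 0 < Re w -> 0 < mu -> Cmod w <= k ^ 2 -> 0 <= k ->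
  Cmod w <= mu ^ 2 + 2 / mu * (- Re (csqrt w * w) + 2 * k * Re w).
Proof.
  intros Hw Hmu Hk Hk0.
  pose proof (half_cube_le _ (re_csqrt_ge_im w Hw)) as I.
  rewrite csqrt_sqr in I by auto.
  rewrite (Cmod_csqrt w Hw) in Hk |- *. pose proof (Cmod_ge_0 (csqrt w)) as S0.
  set (s := Cmod (csqrt w)) in *.
  assert (Hs : s <= k) by nra.
  pose proof (sqr_le_cube mu s Hmu S0) as Q.
  assert (s ^ 3 / mu <= 2 / mu * (- Re (csqrt w * w) + 2 * k * Re w)); [|lra].
  replace (s ^ 3 / mu) with (2 / mu * (s ^ 3 / 2)) by (field; lra).
  apply Rmult_le_compat_l; [apply Rlt_le, Rdiv_lt_0_compat; lra|]. nra.
Qed.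

Lemma sqrt_increment_le x y e : 0 < x -> 0 < y -> 0 < e -> sqrt y - sqrt x <= e + Rabs (y - x) / e.
Proof.
  intros Hx Hy He.
  pose proof (sqrt_sqrt x ltac:(lra)). pose proof (sqrt_sqrt y ltac:(lra)).
  pose proof (sqrt_lt_R0 x Hx). pose proof (sqrt_lt_R0 y Hy).
  assert (P : 0 <= Rabs (y - x) / e) by (apply Rle_mult_inv_pos; [apply Rabs_pos | lra]).
  destruct (Rle_or_lt (sqrt y - sqrt x) e) as [L|L]; [lra|].
  assert (sqrt y - sqrt x <= Rabs (y - x) / e); [|lra].
  apply (Rmult_le_reg_r e); auto. unfold Rdiv. rewrite Rmult_assoc, Rinv_l by lra.
  pose proof (Rle_abs (y - x)). nra.
Qed.

Lemma is_derive_barrier X Y t dX dY D m c k eta : 0 < X t -> eta <> 0 ->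
  is_derive X t dX -> is_derive Y t dY ->
  is_derive (fun s => D * (m * s + c * (- Y s + 2 * k * (2 * sqrt (X s) + X s / eta)))) t
    (D * (m + c * (- dY + 2 * (k * (/ sqrt (X t) + / eta)) * dX))).
Proof.
  intros HX Hn DX DY. pose proof (sqrt_lt_R0 _ HX).
  auto_derive.
  - repeat split; [eexists; exact DY | eexists; exact DX | exact HX | eexists; exact DX].
  - change (Derive (fun s => X s) t) with (Derive X t).
    change (Derive (fun s => Y s) t) with (Derive Y t).
    rewrite (is_derive_unique _ _ _ DX), (is_derive_unique _ _ _ DY).
    field. lra.
Qed.

Section Displacement.
Variables (H : C -> C) (k eta : R).
Hypothesis k_pos : 0 < k.
Hypothesis eta_pos : 0 < eta.
Hypothesis H_diff : forall z, 0 < Re z -> cdiff H z.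
Hypothesis H_pos : forall z, 0 < Re z -> 0 < Re (H z).
Hypothesis H_bound : forall z, 0 < Re z -> Cmod (H z) <= (k * (/ sqrt (Re z) + / eta)) ^ 2.

Let F := half_plane_primitive (fun z => csqrt (H z)).

Lemma cderiv_F z : 0 < Re z -> cderiv F z (csqrt (H z)).
Proof.
  intros Hz. apply (cderiv_primitive (fun z => csqrt (H z))); auto.
  intros w Hw. apply (cdiff_comp H csqrt); auto. apply cdiff_csqrt; auto.
Qed.

Lemma csqrt_H_bound z : 0 < Re z -> Cmod (csqrt (H z)) <= k * (/ sqrt (Re z) + / eta).
Proof.
  intros Hz. pose proof (H_bound z Hz) as B. rewrite Cmod_csqrt in B by auto.
  pose proof (Cmod_ge_0 (csqrt (H z))).
  pose proof (Rinv_0_lt_compat _ (sqrt_lt_R0 _ Hz)). pose proof (Rinv_0_lt_compat _ eta_pos).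
  apply Rsqr_incr_0_var; [rewrite !Rsqr_pow2; exact B | nra].
Qed.

Lemma re_F_line z v t : 0 < Re (z + RtoC t * v) ->
  is_derive (fun s => Re (F (z + RtoC s * v))) t (Re (csqrt (H (z + RtoC t * v)) * v)).
Proof.
  intros P. apply (is_derive_re_curve (fun s => F (z + RtoC s * v))%C).
  apply (curve_deriv_comp F (fun s => z + RtoC s * v)%C); [now apply cderiv_F | apply curve_deriv_line].
Qed.

(** Together with [re_F_across] and [re_F_down], this compares [Re F] at two
    points that may be arbitrarily close to the imaginary axis, by a detour at
    distance at least [eta^2] from it. Moving away from the axis increases [Re F]
    because [csqrt] has positive real part. *)
Lemma re_F_up z : 0 < Re z -> Re (F z) <= Re (F (z + RtoC (eta ^ 2))%C).
Proof.
  intros Hz.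
  pose proof (increment_le (fun _ => 0) (fun s => Re (F (z + RtoC s * 1)%C)) (fun _ => 0)
    (fun t => Re (csqrt (H (z + RtoC t * 1)) * 1)) 0 (eta ^ 2)) as I.
  cbv beta in I. rewrite !Cmult_1_r, Cplus_0_r in I. 
  enough (0 - 0 <= Re (F (z + RtoC (eta ^ 2))%C) - Re (F z)) by lra. apply I; [nra|].
  intros t Ht.
  assert (P : 0 < Re (z + RtoC t * 1)) by (rewrite re_plus, Cmult_1_r; simpl; lra).
  refine (conj _ (conj _ _)).
  - apply (@is_derive_const R_AbsRing R_NormedModule).
  - now apply re_F_line.
  - rewrite Cmult_1_r. apply Rlt_le, csqrt_re_pos. now apply H_pos.
Qed.

(** The bound on [csqrt o H] blows up like [1 / sqrt (Re z)], which is integrable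
    up to the axis: the cost of the way back is independent of [z]. *)
Lemma re_F_down z : 0 < Re z -> Re (F (z + RtoC (eta ^ 2))%C) - Re (F z) <= 3 * k * eta.
Proof.
  intros Hz. 
  pose proof (increment_le (fun s => Re (F (z + RtoC s * 1)%C))
    (fun s => k * (2 * sqrt (Re z + s) + s / eta))
    (fun t => Re (csqrt (H (z + RtoC t * 1)) * 1))
    (fun t => k * (/ sqrt (Re z + t) + / eta)) 0 (eta ^ 2)) as I.
  cbv beta in I. rewrite !Cmult_1_r, Cplus_0_r in I.
  eapply Rle_trans; [apply I; [nra|]|].
  - intros t Ht.
    assert (E : Re (z + RtoC t * 1) = Re z + t) by (rewrite re_plus, Cmult_1_r; reflexivity).
    assert (P : 0 < Re (z + RtoC t * 1)) by lra.
    refine (conj _ (conj _ _)).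
    + now apply re_F_line.
    + pose proof (sqrt_lt_R0 (Re z + t) ltac:(lra)).
      auto_derive; [repeat split; lra | field; repeat split; lra].
    + rewrite Cmult_1_r. eapply Rle_trans; [apply re_le_Cmod_signed|].
      rewrite <- E. now apply csqrt_H_bound.
  - rewrite Rplus_0_r.
    assert (S : sqrt (Re z + eta ^ 2) <= sqrt (Re z) + eta).
    { pose proof (sqrt_lt_R0 _ Hz). pose proof (sqrt_sqrt (Re z) ltac:(lra)).
      apply Rsqr_incr_0_var; [|lra]. rewrite Rsqr_sqrt by nra. unfold Rsqr. nra. }
    replace (eta ^ 2 / eta) with eta by (field; lra). unfold Rdiv. rewrite Rmult_0_l. nra.
Qed.

Lemma re_F_across z w : 0 < Re z -> 0 < Re w ->
  Re (F (z + RtoC (eta ^ 2))%C) - Re (F (w + RtoC (eta ^ 2))%C) <= 2 * k / eta * Cmod (w - z).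
Proof.
  intros Hz Hw.
  set (z' := (z + RtoC (eta ^ 2))%C).
  pose proof (increment_le (fun s => - (2 * k / eta * Cmod (w - z)) * s)
    (fun s => Re (F (z' + RtoC s * (w - z))%C))
    (fun _ => - (2 * k / eta * Cmod (w - z)))
    (fun t => Re (csqrt (H (z' + RtoC t * (w - z))) * (w - z))) 0 1 ltac:(lra)) as I.
  cbv beta in I.
  replace (z' + RtoC 0 * (w - z))%C with z' in I by ring.
  replace (z' + RtoC 1 * (w - z))%C with (w + RtoC (eta ^ 2))%C in I by (unfold z'; ring).
  enough (forall P Q R S : R, - P * 1 - - P * 0 <= Q - S -> S - Q <= P) as A.
  { apply A; auto. apply I.
    intros t Ht.
    assert (E : Re (z' + RtoC t * (w - z)) = (1 - t) * Re z + t * Re w + eta ^ 2).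
    { unfold z'. rewrite !re_plus, re_scal_l, re_minus. change (Re (RtoC (eta ^ 2))) with (eta ^ 2). ring. }
    assert (0 < eta ^ 2) by nra.
    assert (L : eta ^ 2 <= Re (z' + RtoC t * (w - z))) by (rewrite E; nra).
    assert (P : 0 < Re (z' + RtoC t * (w - z))) by lra.
    refine (conj _ (conj _ _)).
    + auto_derive; [auto | ring].
    + now apply re_F_line.
    + pose proof (csqrt_H_bound _ P) as B.
      pose proof (re_le_Cmod_signed (- (csqrt (H (z' + RtoC t * (w - z))) * (w - z)))) as M.
      rewrite re_opp, Cmod_opp, Cmod_mult in M.
      assert (S : / sqrt (Re (z' + RtoC t * (w - z))) <= / eta).
      { apply Rinv_le_contravar; auto. rewrite <- (sqrt_pow2 eta) by lra. now apply sqrt_le_1_alt. }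
      assert (Cmod (csqrt (H (z' + RtoC t * (w - z)))) <= 2 * k / eta).
      { replace (2 * k / eta) with (k * (/ eta + / eta)) by (field; lra). nra. }
      pose proof (Cmod_ge_0 (w - z)). nra. }
  intros; lra.
Qed.

(** The constant depends on [k] only. Here [eta^2] is the length scale and
    [eta^4] the time scale. The displacement [D], multiplied by itself, is the
    increment of [Re (u * p t)]; its derivative is at most [D] times the speed, and
    [speed_bound] makes the latter the derivative of an explicit function of
    position, whose increment is controlled by the detour for [Re F]. The result is
    [D <= C eta^2 + D / 2]. *)
Lemma displacement p a b : a <= b -> b - a <= eta ^ 4 ->
  (forall t, a <= t <= b -> 0 < Re (p t) /\ curve_deriv p t (H (p t))) ->
  Cmod (p b - p a) <= (2048 * k ^ 2 + 1) * eta ^ 2.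
Proof.
  intros Hab Hn Hp.
  destruct (Hp a ltac:(lra)) as [Pa _]. destruct (Hp b ltac:(lra)) as [Pb _].
  set (D := Cmod (p b - p a)).
  assert (D0 : 0 <= D) by apply Cmod_ge_0.
  set (u := Cconj (p b - p a)).
  assert (Du : Cmod u = D) by apply Cmod_conj.
  (* With 32, the terms in D on the right of the final estimate add up to D / 2. *)
  set (mu := 32 * k / eta).
  assert (Hmu : 0 < mu) by (apply Rdiv_lt_0_compat; lra).
  pose proof (increment_le (fun t => Re (u * p t))
    (fun t => D * (mu ^ 2 * t + 2 / mu *
       (- Re (F (p t)) + 2 * k * (2 * sqrt (Re (p t)) + Re (p t) / eta))))
    (fun t => Re (u * H (p t)))
    (fun t => D * (mu ^ 2 + 2 / mu *
       (- Re (csqrt (H (p t)) * H (p t)) + 2 * (k * (/ sqrt (Re (p t)) + / eta)) * Re (H (p t)))))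
    a b Hab) as I.
  cbv beta in I.
  match type of I with ?P -> _ => assert (I1 : P) end.
  { intros t Ht. destruct (Hp t Ht) as [Pt Vt].
    pose proof (sqrt_lt_R0 _ Pt) as St.
    refine (conj _ (conj _ _)).
    - apply (is_derive_re_curve (fun t => u * p t)%C). apply (curve_deriv_comp (fun z => u * z)%C); auto.
      apply cderiv_scal.
    - assert (DF : is_derive (fun t => Re (F (p t))) t (Re (csqrt (H (p t)) * H (p t)))).
      { apply (is_derive_re_curve (fun t => F (p t))). apply curve_deriv_comp; auto. now apply cderiv_F. }
      pose proof (is_derive_re_curve _ _ _ Vt) as DR.
      apply (is_derive_barrier (fun t => Re (p t)) (fun t => Re (F (p t)))); auto. lra.
    - apply Rle_trans with (D * Cmod (H (p t))).
      + rewrite <- Du, <- Cmod_mult. apply re_le_Cmod_signed.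
      + apply Rmult_le_compat_l; auto. apply speed_bound; auto.
        pose proof (Rinv_0_lt_compat _ St). pose proof (Rinv_0_lt_compat _ eta_pos). nra. }
  specialize (I I1). clear I1.
  replace (Re (u * p b) - Re (u * p a)) with (D ^ 2) in I.
  2:{ rewrite <- re_minus. replace (u * p b - u * p a)%C with ((p b - p a) * u)%C by ring.
      unfold u, D. rewrite <- Cmod2_conj. reflexivity. }
  pose proof (re_F_up (p a) Pa) as R1. pose proof (re_F_across (p a) (p b) Pa Pb) as R2.
  pose proof (re_F_down (p b) Pb) as R3. fold D in R2.
  pose proof (sqrt_increment_le _ _ eta Pa Pb eta_pos) as R4.
  pose proof (re_le_Cmod (p b - p a)) as R5. rewrite re_minus in R5. fold D in R5.
  assert (Dn : 0 <= D / eta) by (apply Rle_mult_inv_pos; lra).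
  assert (R6 : Rabs (Re (p b) - Re (p a)) / eta <= D / eta).
  { apply Rmult_le_compat_r; auto. apply Rlt_le, Rinv_0_lt_compat; auto. }
  assert (R7 : Re (p b) / eta - Re (p a) / eta <= D / eta).
  { replace (Re (p b) / eta - Re (p a) / eta) with ((Re (p b) - Re (p a)) / eta) by (field; lra).
    eapply Rle_trans; [|exact R6].
    apply Rmult_le_compat_r; [apply Rlt_le, Rinv_0_lt_compat; auto | apply Rle_abs]. }
  (* The increment along the trajectory of the function of position that comes from
     integrating the speed bound. *)
  set (G := - Re (F (p b)) + 2 * k * (2 * sqrt (Re (p b)) + Re (p b) / eta)
     - (- Re (F (p a)) + 2 * k * (2 * sqrt (Re (p a)) + Re (p a) / eta))).
  assert (HG : G <= k * (8 * (D / eta) + 7 * eta)).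
  { unfold G. replace (2 * k / eta * D) with (2 * k * (D / eta)) in R2 by (field; lra). nra. }
  assert (I' : D ^ 2 <= D * (mu ^ 2 * (b - a) + 2 / mu * G)).
  { eapply Rle_trans; [exact I|]. right. unfold G. ring. }
  assert (M1 : mu ^ 2 * (b - a) <= 1024 * k ^ 2 * eta ^ 2).
  { replace (1024 * k ^ 2 * eta ^ 2) with (mu ^ 2 * eta ^ 4) by (unfold mu; field; lra).
    apply Rmult_le_compat_l; auto. apply pow2_ge_0. }
  assert (M2 : 2 / mu * G <= D / 2 + 7 / 16 * eta ^ 2).
  { replace (D / 2 + 7 / 16 * eta ^ 2) with (2 / mu * (k * (8 * (D / eta) + 7 * eta)))
      by (unfold mu; field; lra).
    apply Rmult_le_compat_l; auto. apply Rlt_le, Rdiv_lt_0_compat; lra. }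
  assert (0 < eta ^ 2) by nra.
  destruct (Rle_lt_or_eq_dec 0 D D0) as [DP|<-]; [|nra].
  assert (D <= mu ^ 2 * (b - a) + 2 / mu * G) by nra.
  lra.
Qed.
End Displacement.

(** * Trajectories of the semigroup *)

(** Take the supremum of the times up to which the inequality holds: by left
    continuity it holds there too, and the bound on the right increments would
    carry it further. *)
Lemma right_mean_value (p : R -> C) v e a b : a <= b ->
  (forall s, a <= s < b -> exists d, 0 < d /\ forall h, 0 < h < d ->
     Cmod (p (s + h) - p s - RtoC h * v) <= e * h) ->
  (forall s, a < s <= b -> forall e', 0 < e' -> exists d, 0 < d /\ forall h, 0 < h < d ->
     Cmod (p (s - h) - p s) <= e') ->
  Cmod (p b - p a - RtoC (b - a) * v) <= e * (b - a).
Proof.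
  intros Hab HR HL.
  set (E := fun s => Cmod (p s - p a - RtoC (s - a) * v)).
  set (S := fun s => a <= s <= b /\ E s <= e * (s - a)).
  assert (Sa : S a).
  { split; [lra|]. unfold E. replace (p a - p a - RtoC (a - a) * v)%C with (RtoC 0).
    - rewrite Cmod_0. lra.
    - rewrite RtoC_minus. ring. }
  destruct (completeness S) as [m [M1 M2]].
  { exists b. intros s [Hs _]. lra. }
  { now exists a. }
  assert (Hm : a <= m <= b).
  { split; [now apply M1 | apply M2; intros s [Hs _]; lra]. }
  assert (Sm : S m).
  { split; auto. destruct (Rle_lt_or_eq_dec a m (proj1 Hm)) as [L|<-]; [|apply Sa].
    apply Rminus_le. apply (Rle_0_of_small _ (1 + Cmod v + Rabs e)).
    { pose proof (Cmod_ge_0 v). pose proof (Rabs_pos e). lra. }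
    intros e' He'. destruct (HL m ltac:(lra) e' He') as [d [Hd H]].
    set (d' := Rmin e' d). assert (0 < d') by (apply Rmin_glb_lt; lra).
    assert (D1 : d' <= e') by apply Rmin_l. assert (D2 : d' <= d) by apply Rmin_r.
    destruct (classic (exists s, S s /\ m - d' < s)) as [[s [Ss Hs]]|N].
    - destruct (Rle_lt_or_eq_dec s m (M1 s Ss)) as [Lt|Eq].
      2:{ rewrite <- Eq. destruct Ss as [_ Ss]. pose proof (Cmod_ge_0 v). pose proof (Rabs_pos e). nra. }
      specialize (H (m - s) ltac:(lra)). replace (m - (m - s)) with s in H by ring.
      destruct Ss as [_ Es]. unfold E in *.
      replace (p m - p a - RtoC (m - a) * v)%C with
        ((p s - p a - RtoC (s - a) * v) - ((p s - p m) + RtoC (m - s) * v))%C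
        by (rewrite !RtoC_minus; ring).
      pose proof (Cmod_triangle_minus (p s - p a - RtoC (s - a) * v)
        ((p s - p m) + RtoC (m - s) * v)) as T1.
      pose proof (Cmod_triangle (p s - p m) (RtoC (m - s) * v)) as T2.
      rewrite Cmod_mult, Cmod_R, Rabs_pos_eq in T2 by lra.
      assert ((m - s) * Cmod v <= e' * Cmod v) by (apply Rmult_le_compat_r; [apply Cmod_ge_0 | lra]).
      assert (e * (s - a) - e * (m - a) <= e' * Rabs e).
      { replace (e * (s - a) - e * (m - a)) with (- e * (m - s)) by ring.
        pose proof (Rle_abs (- e)). rewrite Rabs_Ropp in H2. pose proof (Rabs_pos e). nra. }
      lra.
    - exfalso. assert (m <= m - d'); [|lra]. apply M2. intros s Ss.
      apply Rnot_lt_le. intros K. apply N. now exists s. }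
  destruct (Rle_lt_or_eq_dec m b (proj2 Hm)) as [L|Eq]; [|rewrite <- Eq; apply Sm].
  exfalso. destruct (HR m ltac:(lra)) as [d [Hd H]].
  set (h := Rmin (d / 2) (b - m)). assert (0 < h) by (apply Rmin_glb_lt; lra).
  assert (D1 : h <= d / 2) by apply Rmin_l. assert (D2 : h <= b - m) by apply Rmin_r.
  assert (m + h <= m); [|lra]. apply M1. split; [lra|].
  specialize (H h ltac:(lra)). destruct Sm as [_ Em]. unfold E in *.
  replace (p (m + h)%R - p a - RtoC (m + h - a) * v)%C
    with ((p m - p a - RtoC (m - a) * v) + (p (m + h)%R - p m - RtoC h * v))%C
    by (rewrite !RtoC_minus, RtoC_plus; ring).
  eapply Rle_trans; [apply Cmod_triangle|]. lra.
Qed.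

Lemma compact_point (z : C) : @compact_set C_UniformSpace (fun w => w = z).
Proof.
  intros I U _ HU. destruct (HU z eq_refl) as [i Hi]. exists [i]. intros w ->.
  exists i. split; [now left | assumption].
Qed.

Section Flow.
Variables (H : C -> C) (Phi : R -> C -> C).
Hypothesis Phi_semigroup : continuous_semigroup (half_plane 0) Phi.
Hypothesis H_generator : infinitesimal_generator (half_plane 0) Phi H.

Lemma flow_pos t z : 0 <= t -> 0 < Re z -> 0 < Re (Phi t z).
Proof. intros. now apply (semigroup_maps _ _ Phi_semigroup). Qed.

Lemma generator_diff z : 0 < Re z -> cdiff H z.
Proof. intros Hz. apply ex_derive_cdiff. now apply H_generator. Qed.

Lemma flow_right_0 z e : 0 < Re z -> 0 < e -> exists d, 0 < d /\ forall h, 0 < h < d ->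
  Cmod (Phi h z - z - RtoC h * H z) <= e * h.
Proof.
  intros Hz He. destruct H_generator as [_ G].
  destruct (G (fun w => w = z) (compact_point z) ltac:(now intros w ->) (mkposreal e He))
    as [d Hd].
  exists d. split; [apply cond_pos|]. intros h [Hh Hhd].
  specialize (Hd h). simpl in Hd.
  assert (B : ball 0 d h).
  { change (Rabs (h - 0) < d). rewrite Rminus_0_r, Rabs_pos_eq; lra. }
  specialize (Hd B Hh z eq_refl).
  assert (N : RtoC h <> 0) by (apply Cmod_gt_0; rewrite Cmod_R, Rabs_pos_eq; lra).
  replace (Phi h z - z - RtoC h * H z)%C with (((Phi h z - z) / RtoC h - H z) * RtoC h)%C
    by (field; auto).
  rewrite Cmod_mult, Cmod_R, Rabs_pos_eq by lra. apply Rmult_le_compat_r; lra.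
Qed.

Lemma flow_right t z e : 0 <= t -> 0 < Re z -> 0 < e -> exists d, 0 < d /\ forall h, 0 < h < d ->
  Cmod (Phi (t + h) z - Phi t z - RtoC h * H (Phi t z)) <= e * h.
Proof.
  intros Ht Hz He. destruct (flow_right_0 (Phi t z) e (flow_pos t z Ht Hz) He) as [d [Hd K]].
  exists d. split; auto. intros h Hh. specialize (K h Hh).
  rewrite (semigroup_comp _ _ Phi_semigroup) in K; auto; try lra.
  now rewrite Rplus_comm.
Qed.

Lemma flow_right_cont t z e : 0 <= t -> 0 < Re z -> 0 < e -> exists d, 0 < d /\ forall h, 0 < h < d ->
  Cmod (Phi (t + h) z - Phi t z) <= e.
Proof.
  intros Ht Hz He. destruct (flow_right t z 1 Ht Hz ltac:(lra)) as [d [Hd K]].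
  set (v := H (Phi t z)) in *. pose proof (Cmod_ge_0 v).
  exists (Rmin d (e / (1 + Cmod v))). split.
  { apply Rmin_glb_lt; auto. apply Rdiv_lt_0_compat; lra. }
  intros h [H1 H2].
  assert (L1 := Rmin_l d (e / (1 + Cmod v))). assert (L2 := Rmin_r d (e / (1 + Cmod v))).
  specialize (K h ltac:(lra)).
  pose proof (Cmod_triangle_sub (Phi (t + h)%R z - Phi t z) (RtoC h * v)) as T.
  rewrite Cmod_mult, Cmod_R, Rabs_pos_eq in T by lra.
  assert (h * (1 + Cmod v) <= e); [|lra].
  replace e with (e / (1 + Cmod v) * (1 + Cmod v)) by (field; lra).
  apply Rmult_le_compat_r; lra.
Qed.

(** Since [Phi t z = Phi (t - h) (Phi h z)], the two points are the images of
    [z] and of the nearby point [Phi h z] under one self-map. Schwarz-Pick bounds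
    their distance in terms of [Phi t z] alone, uniformly over the maps
    [Phi (t - h)]. *)
Lemma flow_left_cont t z e : 0 < t -> 0 < Re z -> 0 < e -> exists d, 0 < d /\ forall h, 0 < h < d ->
  Cmod (Phi (t - h) z - Phi t z) <= e.
Proof.
  intros Ht Hz He. set (Q := Phi t z). pose proof (Cmod_ge_0 Q) as Q0.
  set (r := Rmin (1 / 2) (e / (4 * (Cmod Q + 1)))).
  assert (R0 : 0 < r) by (apply Rmin_glb_lt; [lra | apply Rdiv_lt_0_compat; lra]).
  assert (R1 : r <= 1 / 2) by apply Rmin_l.
  assert (R2 : r * (4 * (Cmod Q + 1)) <= e).
  { replace e with (e / (4 * (Cmod Q + 1)) * (4 * (Cmod Q + 1))) at 1 by (field; lra).
    apply Rmult_le_compat_r; [lra | apply Rmin_r]. }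
  destruct (flow_right_cont 0 z (r * Re z) ltac:(lra) Hz ltac:(nra)) as [d [Hd K]].
  exists (Rmin d t). split; [now apply Rmin_glb_lt|]. intros h [H1 H2].
  assert (L1 := Rmin_l d t). assert (L2 := Rmin_r d t).
  specialize (K h ltac:(lra)). rewrite Rplus_0_l, (semigroup_0 _ _ Phi_semigroup) in K by auto.
  pose proof (schwarz_pick (Phi (t - h)) z (Phi h z) (Re z)) as SP.
  rewrite (semigroup_comp _ _ Phi_semigroup) in SP; auto; try lra.
  replace (t - h + h) with t in SP by ring. fold Q in SP. set (P := Phi (t - h) z) in *.
  assert (B : Cmod (P - Q) * Re z <= Cmod (Phi h z - z) * Cmod (P + Cconj Q)).
  { apply SP; [nra|]. intros w Hw.
    assert (W : 0 < Re w).
    { pose proof (re_le_Cmod_signed (z - w)) as L. rewrite re_minus, Cmod_sub_sym in L. lra. }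
    split.
    - apply ex_derive_cdiff. apply (semigroup_holo _ _ Phi_semigroup); [lra | exact W].
    - apply flow_pos; auto; lra. }
  assert (T : Cmod (P + Cconj Q) <= Cmod (P - Q) + 2 * Cmod Q).
  { replace (P + Cconj Q)%C with ((P - Q) + (Q + Cconj Q))%C by ring.
    eapply Rle_trans; [apply Cmod_triangle|]. apply Rplus_le_compat_l.
    eapply Rle_trans; [apply Cmod_triangle|]. rewrite Cmod_conj. lra. }
  pose proof (Cmod_ge_0 (P - Q)) as X0. set (X := Cmod (P - Q)) in *.
  assert (Y : X * Re z <= r * Re z * (X + 2 * Cmod Q)).
  { eapply Rle_trans; [exact B|]. apply Rmult_le_compat; auto; apply Cmod_ge_0. }
  assert (X <= r * (X + 2 * Cmod Q)).
  { apply (Rmult_le_reg_r (Re z)); auto. lra. }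
  nra.
Qed.

(** The generator provides right derivatives only; as these are continuous
    along the trajectory, [right_mean_value] makes them two-sided. *)
Lemma flow_curve_deriv t z : 0 < t -> 0 < Re z -> curve_deriv (fun s => Phi s z) t (H (Phi t z)).
Proof.
  intros Ht Hz e He. set (v := H (Phi t z)).
  pose proof (flow_pos t z ltac:(lra) Hz) as Pt.
  (* Velocities near time t are within e / 2 of v, and right increments are within
     e / 2 of the velocity. *)
  destruct (cdiff_cont _ _ (generator_diff _ Pt) (e / 2) ltac:(lra)) as [r [Hr Hv]].
  destruct (flow_right_cont t z (r / 2) ltac:(lra) Hz ltac:(lra)) as [d1 [D1 K1]].
  destruct (flow_left_cont t z (r / 2) Ht Hz ltac:(lra)) as [d2 [D2 K2]].
  set (d := Rmin t (Rmin d1 d2)).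
  assert (Hd : 0 < d) by (apply Rmin_glb_lt; [|apply Rmin_glb_lt]; lra).
  assert (E0 : d <= t) by apply Rmin_l.
  assert (E1 : d <= d1) by (eapply Rle_trans; [apply Rmin_r | apply Rmin_l]).
  assert (E2 : d <= d2) by (eapply Rle_trans; [apply Rmin_r | apply Rmin_r]).
  exists d. split; auto.
  assert (Hs : forall s, Rabs (s - t) < d -> Cmod (H (Phi s z) - v) < e / 2).
  { intros s Hs. apply Rabs_def2 in Hs. apply Hv.
    destruct (Rtotal_order s t) as [L|[->|L]].
    - specialize (K2 (t - s) ltac:(lra)). replace (t - (t - s)) with s in K2 by ring. lra.
    - replace (Phi t z - Phi t z)%C with (RtoC 0) by ring. now rewrite Cmod_0.
    - specialize (K1 (s - t) ltac:(lra)). replace (t + (s - t)) with s in K1 by ring. lra. }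
  assert (M : forall a b, a <= b -> t - d < a -> b < t + d ->
    Cmod (Phi b z - Phi a z - RtoC (b - a) * v) <= e * (b - a)).
  { intros a b Hab Ha Hb. apply (right_mean_value (fun s => Phi s z)); auto.
    - intros s Hsab. destruct (flow_right s z (e / 2) ltac:(lra) Hz ltac:(lra)) as [d' [D' K]].
      exists d'. split; auto. intros h Hh. specialize (K h Hh).
      specialize (Hs s ltac:(apply Rabs_def1; lra)).
      replace (Phi (s + h) z - Phi s z - RtoC h * v)%C with
        ((Phi (s + h)%R z - Phi s z - RtoC h * H (Phi s z)) + RtoC h * (H (Phi s z) - v))%C by ring.
      eapply Rle_trans; [apply Cmod_triangle|]. rewrite Cmod_mult, Cmod_R, Rabs_pos_eq by lra. nra.
    - intros s Hsab e' He'. apply flow_left_cont; auto. lra. }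
  intros s Hst. apply Rabs_def2 in Hst as Hst'. destruct (Rle_or_lt s t) as [L|L].
  - rewrite Rabs_left1 by lra. specialize (M s t L ltac:(lra) ltac:(lra)).
    replace (Phi s z - Phi t z - RtoC (s - t) * v)%C
      with (- (Phi t z - Phi s z - RtoC (t - s) * v))%C by (rewrite !RtoC_minus; ring).
    rewrite Cmod_opp. lra.
  - rewrite Rabs_pos_eq by lra. apply M; lra.
Qed.

Lemma flow_displacement_limit z t B : 0 < t -> 0 < Re z ->
  (forall s, 0 < s < t -> Cmod (Phi t z - Phi s z) <= B) -> Cmod (Phi t z - z) <= B.
Proof.
  intros Ht Hz HB. apply Rminus_le. apply (Rle_0_of_small _ 1); [lra|]. intros e He.
  destruct (flow_right_cont 0 z e ltac:(lra) Hz He) as [d [Hd K]].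
  set (s := Rmin (d / 2) (t / 2)). assert (0 < s) by (apply Rmin_glb_lt; lra).
  assert (s <= d / 2) by apply Rmin_l. assert (s <= t / 2) by apply Rmin_r.
  specialize (K s ltac:(lra)). rewrite Rplus_0_l, (semigroup_0 _ _ Phi_semigroup) in K by auto.
  specialize (HB s ltac:(lra)).
  pose proof (Cmod_triangle (Phi t z - Phi s z) (Phi s z - z)) as T.
  replace (Phi t z - Phi s z + (Phi s z - z))%C with (Phi t z - z)%C in T by ring. lra.
Qed.
End Flow.

(** Schwarz-Pick on the disc of centre [(X, y)] tangent to the imaginary
    axis, combined with the triangle inequality on both sides. *)
Lemma bound_near_boundary H X x y : 0 < x < X ->
  (forall z, 0 < Re z -> cdiff H z /\ 0 < Re (H z)) ->
  Cmod (H (x, y)) <= 2 * X / x * Cmod (H (X, y)).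
Proof.
  intros Hx HH.
  pose proof (schwarz_pick H (X, y) (x, y) X) as SP.
  rewrite Cmod_hor, Rabs_left in SP by lra.
  assert (B : Cmod (H (X, y) - H (x, y)) * X <= - (x - X) * Cmod (H (X, y) + Cconj (H (x, y)))).
  { apply SP; [lra|]. intros z Hz. apply HH.
    pose proof (re_le_Cmod_signed ((X, y) - z)) as L. rewrite re_minus, Cmod_sub_sym in L. simpl in L. lra. }
  pose proof (Cmod_triangle (H (X, y)) (Cconj (H (x, y)))) as T1. rewrite Cmod_conj in T1.
  pose proof (Cmod_triangle_sub (H (x, y)) (H (X, y))) as T2. rewrite Cmod_sub_sym in T2.
  pose proof (Cmod_ge_0 (H (X, y))).
  apply (Rmult_le_reg_r x); [lra|].
  replace (2 * X / x * Cmod (H (X, y)) * x) with (2 * X * Cmod (H (X, y))) by (field; lra).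
  nra.
Qed.

(** * The implications *)

Section Equivalence.
Variables (H : C -> C) (Phi : R -> C -> C).
Hypothesis H_holo : holomorphic_on (half_plane 0) H.
Hypothesis H_maps : maps_into (half_plane 0) (half_plane 0) H.
Hypothesis Phi_semigroup : continuous_semigroup (half_plane 0) Phi.
Hypothesis H_generator : infinitesimal_generator (half_plane 0) Phi H.

Lemma reciprocal_bound eps : 0 < eps -> Hinfty (half_plane eps) H ->
  exists M, 0 <= M /\ forall z, 0 < Re z -> Cmod (H z) <= M * (1 + / Re z).
Proof.
  intros He [_ [M HM]].
  assert (M0 : 0 <= M).
  { eapply Rle_trans; [apply Cmod_ge_0 | apply (HM (2 * eps, 0))]. unfold half_plane; simpl; lra. }
  exists (M * (1 + 4 * eps)). split; [nra|]. intros z Hz.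
  pose proof (Rinv_0_lt_compat _ Hz) as Iz.
  assert (0 <= M * / Re z) by nra. 
  destruct (Rlt_or_le (Re z) (2 * eps)) as [L|L].
  - pose proof (bound_near_boundary H (2 * eps) (Re z) (Im z) (conj Hz L)) as B.
    rewrite <- surjective_pairing in B.
    eapply Rle_trans.
    { apply B. intros w Hw. split; [now apply ex_derive_cdiff, H_holo | now apply H_maps]. }
    assert (Cmod (H ((2 * eps)%R, Im z)) <= M) by (apply HM; unfold half_plane; simpl; lra).
    unfold Rdiv. assert (0 <= 2 * (2 * eps) * / Re z) by nra.
    apply Rle_trans with (2 * (2 * eps) * / Re z * M); [nra|].
    assert (0 <= M * eps) by nra. nra.
  - assert (Cmod (H z) <= M) by (apply HM; unfold half_plane; lra).
    assert (0 <= M * eps) by nra. assert (0 <= M * eps * / Re z) by nra. nra.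
Qed.

Lemma Hinfty_sub eps : 0 < eps -> (exists M, forall z, eps < Re z -> Cmod (H z) <= M) ->
  Hinfty (half_plane eps) H.
Proof.
  intros He HM. split; auto. intros z Hz. apply H_holo. unfold half_plane in *. lra.
Qed.

Lemma bounded_all_of_some : (exists eps, 0 < eps /\ Hinfty (half_plane eps) H) ->
  forall eps, 0 < eps -> Hinfty (half_plane eps) H.
Proof.
  intros [e0 [He0 B]] eps He. destruct (reciprocal_bound e0 He0 B) as [M [M0 HM]].
  apply Hinfty_sub; auto. exists (M * (1 + / eps)). intros z Hz.
  eapply Rle_trans; [apply HM; lra|]. apply Rmult_le_compat_l; auto.
  apply Rplus_le_compat_l, Rinv_le_contravar; lra.
Qed.

Lemma sup_le_of_bounded : (exists eps, 0 < eps /\ Hinfty (half_plane eps) H) ->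
  exists K eps0 : R, 0 < K /\ 0 < eps0 /\ forall eps : R, 0 < eps < eps0 ->
    Rbar_le (sup_Cmod (half_plane eps) H) (Finite (K / eps)).
Proof.
  intros [e0 [He0 B]]. destruct (reciprocal_bound e0 He0 B) as [M [M0 HM]].
  exists (2 * M + 1), 1. split; [lra|]. split; [lra|]. intros eps He.
  apply (proj2 (Lub_Rbar_correct _)). intros r [z [Hz ->]]. simpl.
  unfold half_plane in Hz. eapply Rle_trans; [apply HM; lra|].
  assert (I1 : / Re z <= / eps) by (apply Rinv_le_contravar; lra).
  assert (I2 : 1 <= / eps) by (rewrite <- Rinv_1; apply Rinv_le_contravar; lra).
  unfold Rdiv. nra.
Qed.

Lemma sup_Cmod_bound K eps z : Rbar_le (sup_Cmod (half_plane eps) H) (Finite K) ->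
  eps < Re z -> Cmod (H z) <= K.
Proof.
  intros HK Hz.
  assert (B : Rbar_le (Finite (Cmod (H z))) (Finite K)).
  { eapply Rbar_le_trans; [|exact HK]. apply (proj1 (Lub_Rbar_correct _)). now exists z. }
  exact B.
Qed.

Lemma bounded_of_sup_le : (exists K eps0 : R, 0 < K /\ 0 < eps0 /\ forall eps : R, 0 < eps < eps0 ->
    Rbar_le (sup_Cmod (half_plane eps) H) (Finite (K / eps))) ->
  exists eps, 0 < eps /\ Hinfty (half_plane eps) H.
Proof.
  intros [K [e0 [HK [He0 B]]]]. exists (e0 / 2). split; [lra|].
  apply Hinfty_sub; [lra|]. exists (K / (e0 / 2)). intros z. apply sup_Cmod_bound, B. lra.
Qed.

(** The time [t] is written [eta^4] with [eta = sqrt (sqrt t)]; the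
    hypothesis at [eps = Re z / 2] or [eps = eta^2 / 2] gives the bound on [H]
    required by [displacement]. *)
Lemma displacement_of_sup_le : (exists K eps0 : R, 0 < K /\ 0 < eps0 /\ forall eps : R, 0 < eps < eps0 ->
    Rbar_le (sup_Cmod (half_plane eps) H) (Finite (K / eps))) ->
  exists K t0 : R, 0 < K /\ 0 < t0 /\ forall t : R, 0 <= t < t0 ->
    forall z : C, half_plane 0 z -> Cmod (Phi t z - z)%C <= K * sqrt t.
Proof.
  intros [K [e0 [HK [He0 B]]]]. set (k := sqrt (2 * K)).
  assert (k0 : 0 < k) by (apply sqrt_lt_R0; lra).
  assert (k2 : k ^ 2 = 2 * K) by (unfold k; rewrite <- Rsqr_pow2; apply Rsqr_sqrt; lra).
  exists (2048 * k ^ 2 + 1), (e0 ^ 2). split; [nra|]. split; [nra|].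
  intros t [Ht0 Ht] z Hz. unfold half_plane in Hz.
  destruct Ht0 as [Ht0|<-].
  2:{ rewrite (semigroup_0 _ _ Phi_semigroup) by auto. replace (z - z)%C with (RtoC 0) by ring.
      rewrite Cmod_0, sqrt_0. lra. }
  pose proof (sqrt_lt_R0 t Ht0) as St. set (n := sqrt (sqrt t)).
  assert (n0 : 0 < n) by now apply sqrt_lt_R0.
  assert (n2 : n ^ 2 = sqrt t) by (unfold n; rewrite <- Rsqr_pow2; apply Rsqr_sqrt; lra).
  assert (n4 : n ^ 4 = t).
  { replace (n ^ 4) with ((n ^ 2) ^ 2) by ring. rewrite n2, <- Rsqr_pow2. apply Rsqr_sqrt. lra. }
  assert (ne : n ^ 2 < e0).
  { rewrite n2. rewrite <- (sqrt_pow2 e0) by lra. apply sqrt_lt_1; nra. }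
  rewrite <- n2. apply (flow_displacement_limit H Phi Phi_semigroup H_generator); auto.
  intros s Hs. apply (displacement H k n k0 n0) with (p := fun s => Phi s z).
  - intros w Hw. now apply ex_derive_cdiff, H_holo.
  - intros w Hw. now apply H_maps.
  - intros w Hw. pose proof (sqrt_lt_R0 _ Hw) as Sw. pose proof (sqrt_sqrt (Re w) ltac:(lra)) as Sw2.
    pose proof (Rinv_0_lt_compat _ Sw). pose proof (Rinv_0_lt_compat _ n0).
    rewrite Rpow_mult_distr, k2.
    destruct (Rlt_or_le (Re w) (n ^ 2)) as [L|L].
    + apply Rle_trans with (K / (Re w / 2)).
      * apply (sup_Cmod_bound _ (Re w / 2)); [apply B; lra | lra].
      * replace (K / (Re w / 2)) with (2 * K * (/ sqrt (Re w)) ^ 2).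
        -- apply Rmult_le_compat_l; [lra|]. apply pow_incr. lra.
        -- rewrite <- Sw2 at 2. field. lra.
    + apply Rle_trans with (K / (n ^ 2 / 2)).
      * apply (sup_Cmod_bound _ (n ^ 2 / 2)); [apply B; nra | nra].
      * replace (K / (n ^ 2 / 2)) with (2 * K * (/ n) ^ 2) by (field; lra).
        apply Rmult_le_compat_l; [lra|]. apply pow_incr. lra.
  - lra.
  - lra.
  - intros r Hr. split.
    + apply (flow_pos Phi Phi_semigroup); lra.
    + apply (flow_curve_deriv H Phi Phi_semigroup H_generator); lra.
Qed.

Lemma uniform_of_displacement : (exists K t0 : R, 0 < K /\ 0 < t0 /\ forall t : R, 0 <= t < t0 ->
    forall z : C, half_plane 0 z -> Cmod (Phi t z - z)%C <= K * sqrt t) ->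
  cv_unif_0 (half_plane 0) Phi (fun z => z).
Proof.
  intros [K [t0 [HK [Ht0 B]]]] e.
  assert (E : 0 < (e / K) ^ 2) by (apply pow_lt, Rdiv_lt_0_compat; auto; apply cond_pos).
  exists (mkposreal (Rmin t0 ((e / K) ^ 2)) (Rmin_glb_lt _ _ _ Ht0 E)).
  intros t Bt Ht z Hz. change (Rabs (t - 0) < Rmin t0 ((e / K) ^ 2)) in Bt.
  rewrite Rminus_0_r, Rabs_pos_eq in Bt by lra.
  assert (L1 := Rmin_l t0 ((e / K) ^ 2)). assert (L2 := Rmin_r t0 ((e / K) ^ 2)).
  eapply Rle_lt_trans; [apply B; auto; lra|].
  replace (pos e) with (K * sqrt ((e / K) ^ 2)).
  - apply Rmult_lt_compat_l; auto. apply sqrt_lt_1; lra.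
  - rewrite sqrt_pow2.
    + field. lra.
    + apply Rlt_le, Rdiv_lt_0_compat; auto. apply cond_pos.
Qed.

(** When [Re z] is large, [H] varies little along the first part of the
    trajectory of [z], which therefore covers a distance of the order of
    [T |H z|]; but that distance is less than 2. *)
Lemma bounded_of_uniform : (exists eps : R, 0 < eps /\ cv_unif_0 (half_plane eps) Phi (fun z => z)) ->
  exists eps, 0 < eps /\ Hinfty (half_plane eps) H.
Proof.
  intros [e0 [He0 B]]. destruct (B (mkposreal 1 Rlt_0_1)) as [T HT]. simpl in HT.
  pose proof (cond_pos T) as T0.
  assert (HT' : forall t z, 0 < t < T -> e0 < Re z -> Cmod (Phi t z - z) < 1).
  { intros t z Ht Hz. apply HT; auto; [|lra].
    change (Rabs (t - 0) < T). rewrite Rminus_0_r, Rabs_pos_eq; lra. }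
  (* A displacement below 1 at abscissa at least 8 is a ratio below 1/8 in
     Schwarz-Pick, which makes H vary by at most half. *)
  exists (Rmax e0 8). assert (L1 := Rmax_l e0 8). assert (L2 := Rmax_r e0 8).
  split; [lra|]. apply Hinfty_sub; [lra|]. exists (16 / T). intros z Hz.
  set (h := Cmod (H z)). assert (h0 : 0 <= h) by apply Cmod_ge_0.
  assert (Hh : forall t, 0 < t < T -> Cmod (H z - H (Phi t z)) <= h / 2).
  { intros t Ht. specialize (HT' t z Ht ltac:(lra)).
    pose proof (schwarz_pick H z (Phi t z) (Re z) ltac:(lra)) as SP.
    match type of SP with ?P -> _ => assert (Q : P) end.
    { intros w Hw. assert (W : 0 < Re w).
      { pose proof (re_le_Cmod_signed (z - w)) as L. rewrite re_minus, Cmod_sub_sym in L. lra. }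
      split; [now apply ex_derive_cdiff, H_holo | now apply H_maps]. }
    specialize (SP Q). clear Q.
    pose proof (Cmod_triangle (H z) (Cconj (H (Phi t z)))) as T1. rewrite Cmod_conj in T1.
    pose proof (Cmod_triangle_sub (H (Phi t z)) (H z)) as T2. rewrite Cmod_sub_sym in T2.
    fold h in T1, T2. set (X := Cmod (H z - H (Phi t z))) in *.
    assert (0 <= X) by apply Cmod_ge_0.
    pose proof (Cmod_ge_0 (H z + Cconj (H (Phi t z)))). pose proof (Cmod_ge_0 (Phi t z - z)).
    nra. }
  set (u := Cconj (H z)). assert (Hu : Cmod u = h) by apply Cmod_conj.
  (* The trajectory is differentiable at positive times, hence a positive start. *)
  set (s := T / 4).
  assert (I : h ^ 2 / 2 * (T / 2 - s) <= h * Cmod (Phi (T / 2) z - Phi s z)).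
  { pose proof (increment_le (fun t => h ^ 2 / 2 * t) (fun t => Re (u * Phi t z))
      (fun _ => h ^ 2 / 2) (fun t => Re (u * H (Phi t z))) s (T / 2) ltac:(unfold s; lra)) as I.
    cbv beta in I. match type of I with ?P -> _ => assert (Q : P) end.
    - intros t Ht. unfold s in Ht. refine (conj _ (conj _ _)).
      + auto_derive; [auto | field].
      + apply (is_derive_re_curve (fun t => u * Phi t z)%C).
        apply (curve_deriv_comp (fun w => u * w)%C (fun t => Phi t z)); [apply cderiv_scal|].
        apply (flow_curve_deriv H Phi Phi_semigroup H_generator); lra.
      + replace (u * H (Phi t z))%C with (H z * u - u * (H z - H (Phi t z)))%C by ring.
        rewrite re_minus. unfold u at 1. rewrite <- Cmod2_conj. fold h.
        change (Re (RtoC (h ^ 2))) with (h ^ 2).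
        pose proof (re_le_Cmod_signed (u * (H z - H (Phi t z)))) as R1.
        rewrite Cmod_mult, Hu in R1. specialize (Hh t ltac:(lra)). nra.
    - specialize (I Q). clear Q. rewrite <- re_minus in I.
      replace (u * Phi (T / 2)%R z - u * Phi s z)%C with (u * (Phi (T / 2)%R z - Phi s z))%C in I by ring.
      pose proof (re_le_Cmod_signed (u * (Phi (T / 2)%R z - Phi s z))) as R1.
      rewrite Cmod_mult, Hu in R1. lra. }
  pose proof (HT' s z ltac:(unfold s; lra) ltac:(lra)) as D1.
  pose proof (HT' (T / 2) z ltac:(lra) ltac:(lra)) as D2.
  pose proof (Cmod_triangle_minus (Phi (T / 2) z - z) (Phi s z - z)) as D3.
  replace (Phi (T / 2)%R z - z - (Phi s z - z))%C with (Phi (T / 2)%R z - Phi s z)%C in D3 by ring.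
  apply (Rmult_le_reg_r T); auto. replace (16 / T * T) with 16 by (field; lra).
  unfold s in I. destruct (Rle_lt_or_eq_dec 0 h h0) as [hp|<-]; [|lra].
  replace (h ^ 2 / 2 * (T / 2 - T / 4)) with (h * (h * T / 8)) in I by field.
  apply Rmult_le_reg_l in I; auto. unfold s in *. lra.
Qed.
End Equivalence.

Theorem theorem1p2 (H : C -> C) (Phi : R -> C -> C)
  (H_holo : holomorphic_on (half_plane 0) H)
  (H_maps : maps_into (half_plane 0) (half_plane 0) H)
  (Phi_semigroup : continuous_semigroup (half_plane 0) Phi)
  (H_generator : infinitesimal_generator (half_plane 0) Phi H) :
  all_equivalent
    [ (exists eps : R, 0 < eps /\ Hinfty (half_plane eps) H);
      (forall eps : R, 0 < eps -> Hinfty (half_plane eps) H);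
      (exists K eps0 : R, 0 < K /\ 0 < eps0 /\
         forall eps : R, 0 < eps < eps0 ->
           Rbar_le (sup_Cmod (half_plane eps) H) (Finite (K / eps)));
      (exists K t0 : R, 0 < K /\ 0 < t0 /\
         forall t : R, 0 <= t < t0 ->
           forall z : C, half_plane 0 z -> Cmod (Phi t z - z)%C <= K * sqrt t);
      cv_unif_0 (half_plane 0) Phi (fun z => z);
      (exists eps : R, 0 < eps /\ cv_unif_0 (half_plane eps) Phi (fun z => z)) ].
Proof.
  pose proof (bounded_all_of_some H H_holo H_maps) as I12.
  pose proof (sup_le_of_bounded H H_holo H_maps) as I13.
  pose proof (bounded_of_sup_le H H_holo) as I31.
  pose proof (displacement_of_sup_le H Phi H_holo H_maps Phi_semigroup H_generator) as I34.
  pose proof (uniform_of_displacement Phi) as I45.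
  pose proof (bounded_of_uniform H Phi H_holo H_maps Phi_semigroup H_generator) as I61.
  intros P Q HP HQ.
  assert (I21 : (forall eps : R, 0 < eps -> Hinfty (half_plane eps) H) ->
    exists eps : R, 0 < eps /\ Hinfty (half_plane eps) H).
  { intros A. exists 1. split; [lra | apply A; lra]. }
  assert (I56 : cv_unif_0 (half_plane 0) Phi (fun z => z) ->
    exists eps : R, 0 < eps /\ cv_unif_0 (half_plane eps) Phi (fun z => z)).
  { intros A. exists 1. split; [lra|]. intros e. destruct (A e) as [d Hd].
    exists d. intros t Bt Ht z Hz. apply Hd; auto. unfold half_plane in *. lra. }
  simpl in HP, HQ.
  repeat destruct HP as [<-|HP]; try contradiction;
    repeat destruct HQ as [<-|HQ]; try contradiction; tauto.
Qed.
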